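(* For any $m\geqslant 0$ the formulas $$(Ag)(\alpha,t_1,\dots,t_{m+1})=(\alpha+t_{m+1})g(\alpha,0,\dots,0)+\sum_{i=2}^{m+1}(t_{i-1}+t_i)\,g(\alpha,t_i,t_{i+1},\dots,t_{m+1},0,\dots,0)+t_1(v_{m+1}g)(\alpha,t_1,\dots,t_{m+1}),$$ $$(Cg)(\alpha,t_1,\dots,t_{m+1})=(\alpha+t_1+\dots+t_{m+1})(v_{m+1}g)(\alpha,t_1,\dots,t_{m+1})+\sum_{i=1}^{m+1}t_i\,g(t_i,t_1,\dots,t_{i-1},0,\dots,0)$$ define linear mappings $A,C:\mathrm{Qsym}[t_1,\dots,t_m][\alpha]\to\mathrm{Qsym}[t_1,\dots,t_{m+1}][\alpha]$ such that $$f_{m+1}(Ap)=A f_m(p)\quad\text{and}\quad f_{m+1}(Cp)=C f_m(p)$$ for any $p\in\mathcal{P}^n$ and $m\geqslant n$.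
   Context: A combinatorial polytope is a combinatorial equivalence class of convex polytopes. The ring of polytopes $\mathcal{P}$ is, as an abelian group, free on all (non-empty) combinatorial polytopes; $\mathcal{P}^n$ is the subgroup generated by $n$-dimensional polytopes. $C:\mathcal{P}\to\mathcal{P}$ and $B:\mathcal{P}\to\mathcal{P}$ are the linear operators sending a polytope $P$ to the cone (pyramid) $CP$ and to the suspension (bipyramid) $BP$ over it, respectively; on the point, $C\,\mathrm{pt}=B\,\mathrm{pt}=I$ (the interval). On $\mathcal{P}$ one sets $A=2C-B$. For a composition $\omega=(j_1,\dots,j_k)$, $j_i\ge1$, $M_\omega=\sum_{l_1<\dots<l_k}t_{l_1}^{j_1}\cdots t_{l_k}^{j_k}$; $\mathrm{Qsym}[t_1,\dots,t_m]$ consists of the integer combinations of the $M_\omega(t_1,\dots,t_m)$ (and constants). $v_{m+1}:\mathrm{Qsym}[t_1,\dots,t_m][\alpha]\to\mathrm{Qsym}[t_1,\dots,t_{m+1}][\alpha]$ is the $\mathbb{Z}[\alpha]$-linear map with $v_{m+1}M_\omega(t_1,\dots,t_m)=M_\omega(t_1,\dots,t_{m+1})$ for compositions $\omega$ with at most $m$ parts. In $g(\cdot,\cdot,\dots)$ the first argument is the value substituted for $\alpha$, followed by $m$ values for $t_1,\dots,t_m$, with zeros filling the remaining places. The linear map $f_m:\mathcal{P}\to\mathrm{Qsym}[t_1,\dots,t_m][\alpha]$ is given on an $n$-dimensional polytope by $$f_m(P^n)=\alpha^n+\sum_{k=1}^{\min\{m,n\}}\ \sum_{0\leqslant a_1<\dots<a_k\leqslant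 n-1}f_{a_1,\dots,a_k}\,\alpha^{a_1}M_{(n-a_k,\,a_k-a_{k-1},\dots,\,a_2-a_1)}(t_1,\dots,t_m),$$ where $f_{a_1,\dots,a_k}$ is the number of chains of faces $F^{a_1}\subset\dots\subset F^{a_k}$ of $P^n$ with $\dim F^{a_i}=a_i$. *)

(* Defs.v *)
From HB Require Import structures.
From mathcomp Require Import all_boot all_order all_algebra.
From mathcomp Require Import mathcomp_extra boolp classical_sets functions.
From mathcomp Require Import cardinality reals.
From mathcomp Require Import finmap freeg mpoly.

Set Implicit Arguments.
Unset Strict Implicit.
Unset Printing Implicit Defensive.

Import Order.TTheory GRing.Theory Num.Theory.

Local Open Scope classical_set_scope.
Local Open Scope quotient_scope.
Local Open Scope ring_scope.

(** * Convex polytopes *)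

Section Affine.
Variable R : realType.

Definition conv_hull d (V : seq 'rV[R]_d) : set 'rV[R]_d :=
  [set x | exists w : 'I_(size V) -> R,
    [/\ forall i, 0 <= w i, \sum_i w i = 1 & x = \sum_i w i *: V`_i]].

Definition affinely_independent d k (p : 'I_k -> 'rV[R]_d) : Prop :=
  forall w : 'I_k -> R,
    \sum_i w i = 0 -> \sum_i w i *: p i = 0 -> forall i, w i = 0.

(* Dimension of the affine hull; the empty set has dimension -1. *)
Definition affine_dim d (S : set 'rV[R]_d) : int :=
  (\max_(k < d.+2 | `[< exists2 p : 'I_k -> 'rV[R]_d,
        forall i, S (p i) & affinely_independent p >]) k)%N%:Z - 1.

(* The inequality [x *m c <= b] is valid on S and F is its equality set; the
   trivial inequalities [0 <= 0] and [0 <= 1] give S itself and the empty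
   face. *)
Definition face d (S F : set 'rV[R]_d) : Prop :=
  exists (c : 'cV[R]_d) (b : R),
    (forall x, S x -> (x *m c) 0 0 <= b) /\
    F = [set x | S x /\ (x *m c) 0 0 = b].

End Affine.

(* A nonempty polytope is presented by a finite generating list, which may
   contain repetitions and points that are not vertices. *)
Record polytope (R : realType) := Polytope {
  ambient : nat;
  generators : seq 'rV[R]_ambient;
  generators_neq0 : generators != [::] }.

HB.instance Definition _ (R : realType) := gen_eqMixin (polytope R).
HB.instance Definition _ (R : realType) := gen_choiceMixin (polytope R).

Section Polytopes.
Variable R : realType.
Implicit Types P Q : polytope R.

Definition pset P : set 'rV[R]_(ambient P) := conv_hull (generators P).

Arguments pset : clear implicits.

Definition pdim P : nat := `|affine_dim (pset P)|%N.

(* Isomorphism of face lattices. *)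
Definition comb_equivalent P Q : Prop :=
  exists (phi : set 'rV[R]_(ambient P) -> set 'rV[R]_(ambient Q)),
    set_bij (face (pset P)) (face (pset Q)) phi /\
    forall F G, face (pset P) F -> face (pset P) G ->
      (F `<=` G <-> phi F `<=` phi G).

(* The pyramid over P, with P placed in the hyperplane of height 0 and the
   apex at height 1. *)
Definition pyramid_pts d (V : seq 'rV[R]_d) : seq 'rV[R]_(d + 1) :=
  row_mx 0 1 :: [seq row_mx v 0 | v <- V].

Definition pyramid P : polytope R :=
  @Polytope R _ (pyramid_pts (generators P)) isT.

(* The barycentre of the generators lies in the relative interior of P, and is
   the midpoint of the segment joining the two apexes. *)
Definition barycentre d (V : seq 'rV[R]_d) : 'rV[R]_d :=
  (size V)%:R^-1 *: \sum_(v <- V) v.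

Definition bipyramid_pts d (V : seq 'rV[R]_d) : seq 'rV[R]_(d + 1) :=
  [:: row_mx (barycentre V) 1, row_mx (barycentre V) (- 1)
    & [seq row_mx v 0 | v <- V]].

Definition bipyramid P : polytope R :=
  @Polytope R _ (bipyramid_pts (generators P)) isT.

Definition face_chains P k (a : k.-tuple nat) :
    set {ffun 'I_k -> set 'rV[R]_(ambient P)} :=
  [set F | (forall i, face (pset P) (F i) /\
                      affine_dim (F i) = (tnth a i)%:Z) /\
           (forall i j : 'I_k, (i <= j)%N -> F i `<=` F j)].

Arguments face_chains : clear implicits.

Definition flag_number P k (a : k.-tuple nat) : nat :=
  #|` fset_set (face_chains P k a)|.

Definition comb_equivb P Q : bool := `[< comb_equivalent P Q >].

Lemma comb_equivb_refl : reflexive comb_equivb.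
Proof.
move=> P; apply/asboolP; exists id; split=> [|F G fF fG]; last by split.
by split=> [F|F G|F fF] //; exists F.
Qed.

Lemma comb_equivb_sym : ssrbool.symmetric comb_equivb.
Proof.
suff H P Q : comb_equivalent P Q -> comb_equivalent Q P.
  by move=> P Q; apply/asboolP/asboolP; apply: H.
move=> [phi [[phiF phiI phiS] phiO]].
have /choice[psi psiP] : forall G, exists F,
    face (pset Q) G -> face (pset P) F /\ phi F = G.
  move=> G; have [/phiS[F fF <-]|nG] := pselect (face (pset Q) G).
    by exists F.
  by exists set0 => /nG.
exists psi; split=> [|F G fF fG].
  split=> [G /psiP[]//|F G| F fF].
    by rewrite !in_setE => /psiP[_ {2}<-] /psiP[_ {2}<-] ->.
  exists (phi F); first exact: phiF.
  have [] := psiP _ (phiF _ fF) => fpF /phiI.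
  by apply; rewrite in_setE.
have [fpF {1}<-] := psiP _ fF; have [fpG {1}<-] := psiP _ fG.
by apply: iff_sym; apply: phiO.
Qed.

Lemma comb_equivb_trans : transitive comb_equivb.
Proof.
move=> Q P S /asboolP[phi [bphi ophi]] /asboolP[psi [bpsi opsi]].
apply/asboolP; exists (psi \o phi); split; first exact: set_bij_comp bpsi.
have [phiF _ _] := bphi.
move=> F G fF fG; rewrite (ophi _ _ fF fG).
by apply: opsi; exact: phiF.
Qed.

Canonical comb_equiv := EquivRel comb_equivb
  comb_equivb_refl comb_equivb_sym comb_equivb_trans.

Definition comb_polytope := {eq_quot comb_equiv}.

End Polytopes.

HB.instance Definition _ (R : realType) := Choice.on (comb_polytope R).

(** * The group of polytopes *)

Section PolytopeGroup.
Variable R : realType.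

Definition polytope_group := {freeg (comb_polytope R)}.

(* Dimension, flag numbers and the two constructions are invariant under
   combinatorial equivalence, so that they may be computed on the chosen
   representative [repr c] of a class c. *)
Definition cdim (c : comb_polytope R) : nat := pdim (repr c).

Definition cpyramid (c : comb_polytope R) : comb_polytope R :=
  \pi_(comb_polytope R) (pyramid (repr c)).

Definition cbipyramid (c : comb_polytope R) : comb_polytope R :=
  \pi_(comb_polytope R) (bipyramid (repr c)).

(* The subgroup generated by the n-dimensional polytopes. *)
Definition homogeneous (n : nat) : set polytope_group :=
  [set p | exists s : seq (int * comb_polytope R),
     (forall x, x \in s -> cdim x.2 = n) /\
     p = \sum_(x <- s) << x.1 *g x.2 >>].

Definition linear_ext (V : zmodType) (f : comb_polytope R -> V)
    (p : polytope_group) : V :=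
  \sum_(c <- dom p) f c *~ coeff c p.

Definition opC : polytope_group -> polytope_group :=
  linear_ext (fun c => << cpyramid c >>).

Definition opB : polytope_group -> polytope_group :=
  linear_ext (fun c => << cbipyramid c >>).

Definition opA (p : polytope_group) : polytope_group := opC p *+ 2 - opB p.

End PolytopeGroup.

(** * Quasi-symmetric polynomials *)

Definition composition (w : seq nat) : bool := all (leq 1) w.

(* M_w(t_1, .., t_m), where t_l is ['X_(l - 1)]; M of the empty composition
   is 1, and M_w = 0 when w has more than m parts. *)
Definition Mqsym m (w : seq nat) : {mpoly int[m]} :=
  \sum_(l : (size w).-tuple 'I_m | sorted ltn [seq val i | i <- l])
    \prod_(i < size w) 'X_(tnth l i) ^+ nth 0%N w i.

Definition Qsym m : set {mpoly int[m]} :=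
  [set q | exists s : seq (int * seq nat),
     (forall x, x \in s -> composition x.2) /\
     q = \sum_(x <- s) Mqsym m x.2 *~ x.1].

(* Qsym[t_1, .., t_m][alpha]; alpha is the variable ['X] of [{poly _}]. *)
Definition QsymA m : set {poly {mpoly int[m]}} :=
  [set g | forall i, Qsym g`_i].

(* v_(m+1) on the coefficients. A monomial t_1^j_1 .. t_k^j_k with all j_i > 0
   occurs in exactly one M_w, namely for w = (j_1, .., j_k), and its coefficient
   there is 1, so that the coefficients of such monomials are the coordinates
   of an element of Qsym in the basis of the M_w; the other monomials are
   discarded (see [vext_coef_Mqsym]). *)
Definition packed m (e : 'X_{1..m}) : bool :=
  sorted (fun x y : nat => (x == 0%N) ==> (y == 0%N)) e.

Definition vext_coef m (q : {mpoly int[m]}) : {mpoly int[m.+1]} :=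
  \sum_(e <- msupp q | packed e)
    Mqsym m.+1 [seq j <- val e | (0 < j)%N] *~ q@_e.

Lemma vext_coefE m (q : {mpoly int[m]}) (E : seq 'X_{1..m}) :
  uniq E -> {subset msupp q <= E} ->
  vext_coef q = \sum_(e <- E | packed e)
    Mqsym m.+1 [seq j <- val e | (0 < j)%N] *~ q@_e.
Proof.
move=> uE sE; rewrite (bigID (mem (msupp q))) /= [X in _ + X]big1 ?addr0.
  rewrite (eq_bigl (fun e => (e \in msupp q) && packed e)) => [|e]; last first.
    by rewrite andbC.
  rewrite -big_filter_cond; apply: perm_big; apply: uniq_perm.
  - exact: msupp_uniq.
  - exact: filter_uniq.
  by move=> e; rewrite mem_filter; case: (boolP (e \in msupp q)) => // /sE ->.
by move=> e /andP[_ /memN_msupp_eq0 ->]; rewrite mulr0z.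
Qed.

Lemma vext_coef_is_additive m : zmod_morphism (@vext_coef m).
Proof.
move=> p q; pose E := undup (msupp p ++ msupp q ++ msupp (p - q)).
rewrite !(@vext_coefE _ _ E) ?undup_uniq //; first last.
- by move=> e; rewrite mem_undup !mem_cat => ->; rewrite ?orbT.
- by move=> e; rewrite mem_undup !mem_cat => ->; rewrite ?orbT.
- by move=> e; rewrite mem_undup !mem_cat => ->; rewrite ?orbT.
by rewrite -sumrB; apply: eq_bigr => e _; rewrite mcoeffB mulrzBr.
Qed.

HB.instance Definition _ m := GRing.isZmodMorphism.Build
  {mpoly int[m]} {mpoly int[m.+1]} (@vext_coef m) (@vext_coef_is_additive m).

Lemma vext_coefX m (e : 'X_{1..m}) : vext_coef 'X_[e] =
  if packed e then Mqsym m.+1 [seq j <- val e | (0 < j)%N] else 0.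
Proof. by rewrite /vext_coef msuppX big_cons big_nil mcoeffX eqxx addr0. Qed.

Lemma vext_coef_Mqsym m (w : seq nat) : composition w -> (size w <= m)%N ->
  vext_coef (Mqsym m w) = Mqsym m.+1 w.
Proof.
move=> w_gt0 w_le.
pose l0 : (size w).-tuple 'I_m := [tuple widen_ord w_le i | i < size w].
rewrite [in LHS]/Mqsym raddf_sum /= (bigD1 l0) /=; last first.
  rewrite -map_comp (eq_map (g := val)) // val_enum_ord.
  exact: iota_ltn_sorted.
pose ex (l : (size w).-tuple 'I_m) : 'X_{1..m} :=
  (\sum_(i < size w) U_(tnth l i) *+ nth 0%N w i)%MM.
have exE (l : (size w).-tuple 'I_m) : sorted ltn [seq val i | i <- l] -> forall j,
    ex l j = if j \in l then nth 0%N w (index j l) else 0%N.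
  move=> sl j; have ul : uniq l.
    by rewrite -(map_inj_uniq val_inj) (sorted_uniq ltn_trans ltnn).
  rewrite mnm_sumE; case: ifPn => [jl|jl]; last first.
    rewrite big1 // => i _; rewrite mulmnE mnm1E; case: eqP => // tj.
    by move: jl; rewrite -tj mem_tnth.
  have il : (index j l < size w)%N by rewrite -[X in (_ < X)%N](size_tuple l) index_mem.
  rewrite (bigD1 (Ordinal il)) //= mulmnE mnm1E (tnth_nth j) /= nth_index //.
  rewrite eqxx mul1n big1 ?addn0 // => i ni; rewrite mulmnE mnm1E.
  case: eqP => // tj; case/eqP: ni; apply: val_inj => /=.
  by rewrite -tj (tnth_nth j) index_uniq // size_tuple.
have exF (l : (size w).-tuple 'I_m) : sorted ltn [seq val i | i <- l] ->
    [seq j <- val (ex l) | (0 < j)%N] = w.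
  move=> sl; have -> : val (ex l) = [seq ex l j | j <- enum 'I_m] :> seq nat.
    apply: (@eq_from_nth _ 0%N) => [|i]; first by rewrite size_tuple size_map size_enum_ord.
    rewrite size_tuple => im; rewrite (nth_map (Ordinal im)) ?size_enum_ord //.
    by rewrite (nth_ord_enum _ (Ordinal im)) (mnm_nth 0%N).
  rewrite filter_map (eq_filter (a2 := mem l)) => [|j /=]; last first.
    rewrite exE //; case: ifP => // jl; move/allP: w_gt0; apply.
    by rewrite mem_nth // -[X in (_ < X)%N](size_tuple l) index_mem.
  have -> : [seq j <- enum 'I_m | mem l j] = l.
    apply: (@irr_sorted_eq _ (relpre (@nat_of_ord m) ltn)).
    - by move=> ? ? ?; exact: ltn_trans.
    - by move=> ?; rewrite /= ltnn.
    - apply: sorted_filter; first by move=> ? ? ?; exact: ltn_trans.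
      by rewrite -sorted_map val_enum_ord iota_ltn_sorted.
    - by rewrite -sorted_map.
    - by move=> j; rewrite mem_filter mem_enum andbT.
  apply: (@eq_from_nth _ 0%N) => [|i]; first by rewrite size_map size_tuple.
  rewrite size_map size_tuple => iw.
  have ul : uniq l.
    by rewrite -(map_inj_uniq val_inj) (sorted_uniq ltn_trans ltnn).
  have j0 : 'I_m by exact: (Ordinal (leq_trans iw w_le)).
  rewrite (nth_map j0) ?size_tuple // exE // mem_nth ?size_tuple //.
  by rewrite index_uniq // size_tuple.
have prodE (l : (size w).-tuple 'I_m) : \prod_(i < size w) 'X_(tnth l i) ^+ nth 0%N w i
    = 'X_[ex l] :> {mpoly int[m]} by rewrite mprodXnE.
have ex_pos (l : (size w).-tuple 'I_m) : sorted ltn [seq val i | i <- l] ->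
    forall j, (ex l j == 0%N) = (j \notin l).
  move=> sl j; rewrite exE //; case: ifP => //= jl; apply/negbTE.
  rewrite -lt0n; move/allP: w_gt0; apply.
  by rewrite mem_nth // -[X in (_ < X)%N](size_tuple l) index_mem.
have packedP (e : 'X_{1..m}) : packed e =
    [forall i : 'I_m, forall j : 'I_m,
      (i <= j)%N ==> (e i == 0%N) ==> (e j == 0%N)].
  rewrite /packed; have tr : transitive (fun x y : nat => (x == 0%N) ==> (y == 0%N)).
    by move=> [|y] [|x] [|z].
  have rf : reflexive (fun x y : nat => (x == 0%N) ==> (y == 0%N)) by case.
  apply/idP/forallP => [sE i|H].
    apply/forallP => j; apply/implyP => ij.
    rewrite !(mnm_nth 0%N).
    by apply: (sorted_leq_nth tr rf 0%N sE); rewrite ?inE ?size_tuple.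
  apply/(sortedP 0%N) => i; rewrite size_tuple => im.
  have /forallP/(_ (Ordinal im))/implyP/(_ (leqnSn _)) := H (Ordinal (ltnW im)).
  by rewrite !(mnm_nth 0%N).
have sl0 : sorted ltn [seq val i | i <- l0].
  rewrite -map_comp (eq_map (g := val)) // val_enum_ord.
  exact: iota_ltn_sorted.
have in_l0 (j : 'I_m) : (j \in l0) = (j < size w)%N.
  apply/tnthP/idP => [[i ->]|jw]; first by rewrite tnth_mktuple /=.
  by exists (Ordinal jw); rewrite tnth_mktuple; apply: val_inj.
rewrite prodE vext_coefX exF // packedP ifT; last first.
  apply/forallP => i; apply/forallP => j; rewrite !ex_pos // !in_l0.
  by apply/implyP => ij; apply/implyP; rewrite -!leqNgt => /leq_trans; apply.
rewrite big1 ?addr0 // => l /andP[sl nl]; rewrite prodE vext_coefX packedP.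
case: ifP => // /forallP H; case/eqP: nl.
have dc (i j : 'I_m) : (i <= j)%N -> j \in l -> i \in l.
  move=> ij; have /forallP/(_ j)/implyP/(_ ij) := H i.
  rewrite !ex_pos // => /implyP h jl; apply: contraTT jl; exact: h.
have ul : uniq l.
  by rewrite -(map_inj_uniq val_inj) (sorted_uniq ltn_trans ltnn).
have ul0 : uniq l0.
  by rewrite -(map_inj_uniq val_inj) (sorted_uniq ltn_trans ltnn).
have sub : {subset l0 <= l}.
  move=> j; rewrite in_l0 => jw; apply/negPn/negP => jl.
  have lt i : i \in l -> (i < j)%N.
    by move=> il; rewrite ltnNge; apply/negP => /dc /(_ il); apply/negP.
  have uv : uniq [seq val i | i <- l] by rewrite (map_inj_uniq val_inj).
  have /(uniq_leq_size uv) : {subset [seq val i | i <- l] <= iota 0 j}.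
    by move=> _ /mapP[i il ->]; rewrite mem_iota /= add0n lt.
  by rewrite size_map size_tuple size_iota leqNgt jw.
apply: val_inj; apply: (@irr_sorted_eq _ (relpre (@nat_of_ord m) ltn)).
- by move=> ? ? ?; exact: ltn_trans.
- by move=> ?; rewrite /= ltnn.
- by rewrite -sorted_map.
- by rewrite -sorted_map.
have [|_ h] := uniq_min_size ul0 sub; first by rewrite !size_tuple.
by move=> j; rewrite h.
Qed.

Definition vext m (g : {poly {mpoly int[m]}}) : {poly {mpoly int[m.+1]}} :=
  \poly_(i < size g) vext_coef g`_i.

Lemma coef_vext m (g : {poly {mpoly int[m]}}) i :
  (vext g)`_i = vext_coef g`_i.
Proof.
rewrite coef_poly; case: ltnP => // h.
by rewrite [in RHS]nth_default // raddf0.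
Qed.

(** * The maps f_m, A and C on quasi-symmetric polynomials *)

(* For a = (a_1, .., a_k), k > 0: (n - a_k, a_k - a_(k-1), .., a_2 - a_1). *)
Definition gaps (n : nat) (a : seq nat) : seq nat :=
  rev (pairmap (fun x y => y - x)%N (head 0%N a) (rcons (behead a) n)).

Definition f_class (R : realType) (m : nat) (c : comb_polytope R) :
    {poly {mpoly int[m]}} :=
  let n := cdim c in
  'X^n + \sum_(1 <= k < (minn m n).+1)
    \sum_(a : k.-tuple 'I_n | sorted ltn [seq val i | i <- a])
      (Mqsym m (gaps n [seq val i | i <- a]))%:P
        * 'X^(head 0%N [seq val i | i <- a])
        *+ flag_number (repr c) [tuple of [seq val i | i <- a]].

Definition f_poly (R : realType) (m : nat) :
    polytope_group R -> {poly {mpoly int[m]}} :=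
  linear_ext (@f_class R m).

(* g(x, s_1, s_2, ..): x is substituted for alpha and the entries of s for
   t_1, t_2, .., with zeros when s is too short. *)
Definition subst m (S : comNzRingType) (g : {poly {mpoly int[m]}})
    (x : S) (s : seq S) : S :=
  (map_poly (mmap intr (fun i : 'I_m => nth 0 s i)) g).[x].

Section Formulas.
Variable m : nat.
Implicit Types g : {poly {mpoly int[m]}}.

Local Notation alpha := ('X : {poly {mpoly int[m.+1]}}).

(* t_1, .., t_(m+1) in Qsym[t_1, .., t_(m+1)][alpha]. *)
Definition tvar (j : nat) : {poly {mpoly int[m.+1]}} :=
  ('X_(inord j.-1 : 'I_m.+1))%:P.

(* t_i, t_(i+1), .., t_j *)
Definition tvars (i j : nat) : seq {poly {mpoly int[m.+1]}} :=
  [seq tvar l | l <- index_iota i j.+1].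

Definition qsA g : {poly {mpoly int[m.+1]}} :=
  (alpha + tvar m.+1) * subst g alpha [::]
  + \sum_(2 <= i < m.+2)
      (tvar i.-1 + tvar i) * subst g alpha (tvars i m.+1)
  + tvar 1 * vext g.

Definition qsC g : {poly {mpoly int[m.+1]}} :=
  (alpha + \sum_(1 <= i < m.+2) tvar i) * vext g
  + \sum_(1 <= i < m.+2) tvar i * subst g (tvar i) (tvars 1 i.-1).

End Formulas.

(* Main.v *)
(* With dim P = n and the convention F_(k+1) = P, the polynomial f_m(P) is the
   sum of alpha^(dim F_1) M_w over the chains F_1 < .. < F_k of nonempty proper
   faces, where w lists the gaps dim F_(i+1) - dim F_i from the top down. The
   faces of the pyramid are the pairs (F, s), where s tells whether the apex is
   used, and the proper faces of the bipyramid are the pairs of a proper face F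
   and at most one of two apexes. Sorting the chains of CP by their projection
   to P turns alpha^a M_w into alpha^(a+1) M_w + alpha^a M_1 M_w + M_(w,a+1); in
   2CP - BP the chains with an apex on a proper face cancel, and alpha^a M_(j,..)
   becomes alpha^a (M_(j+1,..) + 2 M_(1,j,..)). The formulas for A and C act in
   the same way on alpha^a M_w. Dimensions and flag numbers are invariants of the
   face lattice, because a nonempty face of dimension d has a face of dimension
   d - 1, so that the dimension is determined by the order. *)

From HB Require Import structures.
Require Import Defs.
From mathcomp Require Import all_boot all_order all_algebra.
From mathcomp Require Import boolp classical_sets functions cardinality reals.
From mathcomp Require Import finmap freeg mpoly.
From mathcomp Require Import ssrAC ring lra zify.

Set Implicit Arguments.
Unset Strict Implicit.
Unset Printing Implicit Defensive.

Import Order.TTheory GRing.Theory Num.Theory.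

Local Open Scope classical_set_scope.
Local Open Scope quotient_scope.
Local Open Scope ring_scope.

(** * Monomial quasi-symmetric functions *)

(** The class of a pyramid or bipyramid is represented by an arbitrary [repr], known only up to its
    face lattice, so the argument cannot rely on coordinates of that representative. Faces are
    therefore replaced by elements of an abstract ranked poset ([gposet]), and a polytope enters
    through an order isomorphism ([models]). Both sides become sums over chains of a weight F(a, w).
    The cone and suspension identities hold for every F with values in an abelian group; F has to
    stay arbitrary because passing to a smaller element prefixes a gap to w and so changes F. They
    turn a chain sum over the new poset into one over the old poset with a new weight, and for F(a,
    w) = alpha^a M_w this weight is the image of alpha^a M_w under C or A, which passes through the
    sum by additivity. The condition m >= n is used twice: f_m discards chains with more than m
    members, and v_(m+1) is known on M_w only when w has at most m parts. A chain of nonempty proper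
    faces of an n-polytope has at most n members, so neither restriction bites. *)

Lemma big_tupleS (V : nmodType) (T : finType) n (P : pred (seq T))
    (F : n.+1.-tuple T -> V) :
  \sum_(l : n.+1.-tuple T | P l) F l =
  \sum_x \sum_(l : n.-tuple T | P (x :: l)) F [tuple of x :: l].
Proof.
rewrite pair_big_dep /=.
rewrite (reindex (fun p : T * n.-tuple T => [tuple of p.1 :: p.2])) /=.
  by apply: eq_bigl.
exists (fun l : n.+1.-tuple T => (thead l, [tuple of behead l])).
  by case=> x l _; congr pair; apply: val_inj.
by move=> l _; apply: val_inj; rewrite /= [in RHS](tuple_eta l).
Qed.

Lemma big_tuple0 (V : nmodType) (T : finType) (P : pred (seq T))
    (F : 0.-tuple T -> V) :
  P [::] -> \sum_(l : 0.-tuple T | P l) F l = F [tuple].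
Proof.
move=> P0; rewrite (bigD1 [tuple]) //= big1 ?addr0 // => l /andP[_ /eqP].
by case; rewrite tuple0.
Qed.

Section Mlist.
Variable S : comNzRingType.

(* M_w evaluated at the sequence of values [s]. *)
Fixpoint Mlist (s : seq S) (w : seq nat) {struct s} : S :=
  match w, s with
  | [::], _ => 1
  | _ :: _, [::] => 0
  | j :: w', x :: s' => Mlist s' w + x ^+ j * Mlist s' w'
  end.

Lemma Mlist0 s : Mlist s [::] = 1. Proof. by case: s. Qed.

(** The recursion of [Mlist] splits the subsequences of [e] by whether they use its first entry. *)
Lemma sum_subseq_Mlist (T : finType) (h : T -> S) (e : seq T) w : uniq e ->
  \sum_(l : (size w).-tuple T | subseq l e)
    \prod_(i < size w) h (tnth l i) ^+ nth 0%N w i = Mlist [seq h i | i <- e] w.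
Proof.
elim: e w => [|y e IHe] [|j w] //=.
- by move=> _; rewrite (@big_tuple0 _ _ (fun l => subseq l [::])) // big_ord0.
- move=> _; rewrite big1 // => l /eqP l0.
  by have := size_tuple l; rewrite l0.
- by move=> _; rewrite (@big_tuple0 _ _ (fun l => subseq l (y :: e))) // big_ord0.
case/andP=> ye ue; rewrite -(IHe w) // -(IHe (j :: w)) //=.
rewrite [LHS](big_tupleS (fun l => subseq l (y :: e))).
rewrite [X in X + _](big_tupleS (fun l => subseq l e)).
rewrite (bigD1 y) //= [in RHS](bigD1 y) //= eqxx.
rewrite [X in _ = X + _ + _]big1 ?add0r => [|l /mem_subseq/(_ y)]; last first.
  by rewrite inE eqxx (negPf ye) => /(_ isT).
rewrite addrC; congr (_ + _).
  by apply: eq_bigr => x /negPf xy; rewrite xy.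
rewrite big_distrr /=; apply: eq_bigr => l _.
rewrite big_ord_recl tnth0; congr (_ * _); apply: eq_bigr => i _.
by rewrite tnthS.
Qed.

Lemma sum_sorted_Mlist m (h : 'I_m -> S) w :
  \sum_(l : (size w).-tuple 'I_m | sorted ltn [seq val i | i <- l])
    \prod_(i < size w) h (tnth l i) ^+ nth 0%N w i
  = Mlist [seq h i | i <- enum 'I_m] w.
Proof.
rewrite -sum_subseq_Mlist ?enum_uniq //; apply: eq_bigl => l.
rewrite sorted_map; apply/idP/idP => [sl|ss].
  (* An increasing tuple is the enumeration filtered by its own members. *)
  rewrite (_ : tval l = [seq j <- enum 'I_m | j \in l]) ?filter_subseq //.
  have tr : transitive (relpre (@nat_of_ord m) ltn).
    by move=> ? ? ?; exact: ltn_trans.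
  apply: irr_sorted_eq (tr) _ _ _ sl _ _ => [i|| i]; first by rewrite /= ltnn.
    apply: sorted_filter => //.
    by rewrite -sorted_map val_enum_ord iota_ltn_sorted.
  by rewrite mem_filter mem_enum andbT.
apply: subseq_sorted ss _; first by move=> ? ? ?; exact: ltn_trans.
by rewrite -sorted_map val_enum_ord iota_ltn_sorted.
Qed.

(** Positive parts matter here: a part 0 would contribute [0 ^+ 0 = 1] at a padding zero. *)
Lemma Mlist_cat_nseq0 s k w : composition w -> Mlist (s ++ nseq k 0) w = Mlist s w.
Proof.
elim: s w => [|x s IHs] [|j w]; rewrite ?Mlist0 //= => /andP[j0 cw].
  elim: k => //= k ->; by rewrite expr0n eqn0Ngt j0 mul0r addr0.
by rewrite !IHs //= j0.
Qed.

Lemma Mlist_oversize s w : (size s < size w)%N -> Mlist s w = 0.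
Proof.
elim: s w => [|x s IHs] [|j w] //= sw.
by rewrite !IHs ?mulr0 ?addr0 // ltnW.
Qed.

Lemma Mlist_cons_suffix s j w :
  Mlist s (j :: w) = \sum_(0 <= i < size s) s`_i ^+ j * Mlist (drop i.+1 s) w.
Proof.
elim: s => [|x s IHs]; first by rewrite big_nil.
by rewrite /= big_nat_recl //= drop0 addrC IHs.
Qed.

(** In s_i M_w(s_i, s_(i+1), ..) the first index of M_w is either beyond i, giving M_(1,w), or equal
    to i, where the extra factor raises the first part. *)
Lemma sum_suffix_Mlist s w :
  \sum_(0 <= i < size s) s`_i * Mlist (drop i s) w =
  Mlist s (1%N :: w) + (if w is j :: w' then Mlist s (j.+1 :: w') else 0).
Proof.
elim: s => [|x s IHs]; first by rewrite big_nil; case: w => *; rewrite addr0.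
rewrite /= big_nat_recl //= IHs expr1; case: w {IHs} => [|j w].
  by rewrite !addr0 addrC Mlist0.
by rewrite exprS; ring.
Qed.

Lemma Mlist_rcons s x w : Mlist (rcons s x) w =
  Mlist s w + (if w is j :: w' then x ^+ last j w' * Mlist s (belast j w') else 0).
Proof.
elim: s w => [|y s IHs] [|j w] //=; rewrite ?addr0 //.
  by case: w => [|i w] /=; rewrite ?mulr0 ?mulr1 // add0r.
rewrite !IHs; case: w => [|i w] /=; first by rewrite !Mlist0; ring.
by ring.
Qed.

(** The index i lies beyond all indices used by w, so it carries a new last part b. *)
Lemma sum_prefix_Mlist s w b :
  \sum_(0 <= i < size s) s`_i ^+ b * Mlist (take i s) w = Mlist s (rcons w b).
Proof.
elim/last_ind: s => [|s x IHs]; first by rewrite big_nil; case: w => *; rewrite ?addr0.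
rewrite size_rcons big_nat_recr //= nth_rcons ltnn eqxx Mlist_rcons.
rewrite -cats1 take_size_cat //; congr (_ + _).
  rewrite -IHs; apply: eq_big_nat => i /andP[_ si].
  by rewrite nth_cat si take_cat si.
by case: w {IHs} => [|j w] //=; rewrite last_rcons belast_rcons.
Qed.

(* The compositions w' such that M_1 M_w is the sum of the M_w'. *)
Fixpoint quasishuffle1 (w : seq nat) : seq (seq nat) :=
  if w is j :: w' then
    [:: 1%N :: w, j.+1 :: w' & [seq j :: v | v <- quasishuffle1 w']]
  else [:: [:: 1%N]].

(** The index contributed by M_1 falls before the first index of M_w, on it, or after it: these are
    the three kinds of words in [quasishuffle1]. *)
Lemma mul_Mlist1 s w :
  Mlist s [:: 1%N] * Mlist s w = \sum_(v <- quasishuffle1 w) Mlist s v.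
Proof.
elim: s w => [|x s IHs] [|j w]; rewrite ?big_seq1 ?Mlist0 ?mulr1 //.
  rewrite /= !big_cons big_map mul0r big1 // !addr0.
  by [].
(* The words [j :: v] are split by whether j sits on x. The induction hypothesis at [j :: w] covers
   the half without x, once the words [1 :: j :: w] and [j.+1 :: w] are subtracted; the one at w
   covers the other half. *)
have E : \sum_(v <- quasishuffle1 w) Mlist (x :: s) (j :: v) =
    Mlist s [:: 1%N] * Mlist s (j :: w) - Mlist s (1%N :: j :: w)
    - Mlist s (j.+1 :: w) + x ^+ j * (Mlist s [:: 1%N] * Mlist s w).
  rewrite !IHs /= big_split -mulr_sumr /= !big_cons big_map.
  set A := \sum_(i <- _) Mlist s (j :: i); set B := \sum_(i <- _) Mlist s i.
  ring.
by rewrite /= !big_cons big_map {}E /= Mlist0 (exprS x j) expr1; ring.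
Qed.

(** This is the shape of the formula for A. The sum of s_i M_w(s_(i+1), ..) is M_(1,w), and its last
    term is s_n M_w at no variables; the sum of s_i M_w(s_i, ..) is given by [sum_suffix_Mlist], and
    its first term is s_0 M_w(s). These two boundary terms are the ones written apart. M_w at no
    variables is 1 for empty w and 0 otherwise, so x survives only for empty w. *)
Lemma Mlist_recurrence s n w x : size s = n.+1 ->
  (x + s`_n) * Mlist [::] w
  + \sum_(0 <= i < n) (s`_i + s`_i.+1) * Mlist (drop i.+1 s) w
  + s`_0 * Mlist s w
  = (if w is j :: w' then Mlist s (j.+1 :: w') else x) + Mlist s (1%N :: w) *+ 2.
Proof.
move=> sn; under eq_bigr do rewrite mulrDl.
rewrite big_split /=; have := Mlist_cons_suffix s 1 w.
rewrite sn big_nat_recr //= drop_oversize ?sn // expr1.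
under eq_bigr do rewrite expr1.
have := sum_suffix_Mlist s w; rewrite sn big_nat_recl // drop0.
move: (\sum_(0 <= i < n) _) (\sum_(0 <= i < n) _) => X Y EX EY.
have -> : (if w is j :: w' then Mlist s (j.+1 :: w') else x) =
    (if w is j :: w' then Mlist s (j.+1 :: w') else 0) + x * Mlist [::] w.
  by case: (w) => [|? ?]; rewrite /= ?mulr0 ?mulr1 ?addr0 ?add0r.
have -> : X = Mlist s (1%N :: w) - s`_n * Mlist [::] w by rewrite EY addrK.
have -> : Y = Mlist s (1%N :: w)
    + (if w is j :: w' then Mlist s (j.+1 :: w') else 0) - s`_0 * Mlist s w.
  by rewrite -EX addrC addKr.
by case: (w) => [|j v] /=; ring.
Qed.

End Mlist.

Lemma mmap_Mqsym (S : comNzRingType) m (h : 'I_m -> S) w :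
  mmap intr h (Mqsym m w) = Mlist [seq h i | i <- enum 'I_m] w.
Proof.
rewrite /Mqsym raddf_sum -sum_sorted_Mlist; apply: eq_bigr => l _ /=.
rewrite rmorph_prod; apply: eq_bigr => i _.
by rewrite rmorphXn /= mmapX mmap1U.
Qed.

(** * The action of A and C on alpha^a M_w *)

Definition qmono m (a : nat) (w : seq nat) : {poly {mpoly int[m]}} :=
  (Mqsym m w)%:P * 'X^a.

Lemma subst_qmono (S : comNzRingType) m a w (x : S) (s : seq S) :
  composition w -> (size s <= m)%N ->
  subst (qmono m a w) x s = Mlist s w * x ^+ a.
Proof.
move=> cw sm; rewrite /subst rmorphM /= map_polyC map_polyXn hornerM hornerC.
rewrite hornerXn /= mmap_Mqsym -(Mlist_cat_nseq0 s (m - size s)) //.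
congr (Mlist _ _ * _); apply: (@eq_from_nth _ 0).
  by rewrite size_map size_enum_ord size_cat size_nseq subnKC.
rewrite size_map size_enum_ord => i im.
rewrite (nth_map (Ordinal im)) ?size_enum_ord // (nth_ord_enum _ (Ordinal im)) /=.
rewrite nth_cat nth_nseq; case: ltnP => si //.
by rewrite nth_default // if_same.
Qed.

Section Tvars.
Variable m : nat.
Let T := tvars m 1 m.+1.

Lemma size_tvars : size T = m.+1.
Proof. by rewrite size_map size_iota subn1. Qed.

Lemma nth_tvars i : (i < m.+1)%N -> T`_i = tvar m i.+1.
Proof.
move=> im; rewrite (nth_map 0%N) ?size_iota ?subn1 //.
by rewrite nth_iota ?subn1 // add1n.
Qed.

Lemma tvars_drop i : (i <= m.+1)%N -> tvars m i.+1 m.+1 = drop i T.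
Proof.
move=> im; rewrite /T /tvars -map_drop /index_iota drop_iota.
by congr [seq _ | _ <- iota _ _]; lia.
Qed.

Lemma tvars_take i : (i <= m.+1)%N -> tvars m 1 i = take i T.
Proof.
move=> im; rewrite /T /tvars -map_take /index_iota take_iota.
by congr [seq _ | _ <- iota _ _]; lia.
Qed.

Lemma polyC_Mqsym w : (Mqsym m.+1 w)%:P = Mlist T w.
Proof.
rewrite (_ : T = [seq ('X_i)%:P | i <- enum 'I_m.+1]).
  rewrite -sum_sorted_Mlist raddf_sum; apply: eq_bigr => l _ /=.
  by rewrite rmorph_prod; apply: eq_bigr => i _; rewrite rmorphXn.
apply: (@eq_from_nth _ 0) => [|i]; rewrite size_tvars.
  by rewrite size_map size_enum_ord.
move=> im; rewrite nth_tvars // /tvar /=.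
rewrite (nth_map (Ordinal im)) ?size_enum_ord // (nth_ord_enum _ (Ordinal im)).
by congr ('X_ _)%:P; apply: val_inj; rewrite /= inordK.
Qed.

Lemma qmonoE a w : qmono m.+1 a w = Mlist T w * 'X^a.
Proof. by rewrite /qmono polyC_Mqsym. Qed.

Lemma vext_qmono a w : composition w -> (size w <= m)%N ->
  vext (qmono m a w) = qmono m.+1 a w.
Proof.
move=> cw wm; apply/polyP => i; rewrite coef_vext !coefCM !coefXn.
case: eqP => _; last by rewrite !mulr0 raddf0.
by rewrite !mulr1 vext_coef_Mqsym.
Qed.

Lemma vextB (g h : {poly {mpoly int[m]}}) : vext (g - h) = vext g - vext h.
Proof. by apply/polyP => i; rewrite !(coef_vext, coefB) raddfB. Qed.

Lemma substB (S : comNzRingType) (g h : {poly {mpoly int[m]}}) x (s : seq S) :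
  subst (g - h) x s = subst g x s - subst h x s.
Proof. by rewrite /subst raddfB hornerD hornerN. Qed.

Lemma qsA_is_additive : zmod_morphism (@qsA m).
Proof.
move=> p q; rewrite /qsA vextB substB. 
under eq_bigr do rewrite substB mulrBr.
rewrite sumrB.
move: (subst p 'X [::]) (subst q 'X [::]) (vext p) (vext q).
move: (tvar m m.+1) (tvar m 1) => x y.
move: (\sum_(2 <= i < m.+2) _) (\sum_(2 <= i < m.+2) _).
move: ('X : {poly _}) => a *.
ring.
Qed.

Lemma qsC_is_additive : zmod_morphism (@qsC m).
Proof.
move=> p q; rewrite /qsC vextB.
under [X in _ + X]eq_bigr do rewrite substB mulrBr.
rewrite sumrB.
move: (vext p) (vext q) (\sum_(1 <= i < m.+2) tvar m i) => *.
ring.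
Qed.

HB.instance Definition _ := GRing.isZmodMorphism.Build _ _ (@qsA m) qsA_is_additive.
HB.instance Definition _ := GRing.isZmodMorphism.Build _ _ (@qsC m) qsC_is_additive.

Lemma qsA_qmono a w : composition w -> (size w <= m)%N ->
  qsA (qmono m a w) =
  (if w is j :: w' then qmono m.+1 a (j.+1 :: w') else qmono m.+1 a.+1 [::])
  + qmono m.+1 a (1%N :: w) *+ 2.
Proof.
move=> cw wm; rewrite /qsA vext_qmono // subst_qmono // qmonoE.
rewrite big_add1 [X in _ + X + _]/= big_add1 [X in _ + X + _]/=.
have -> : \sum_(0 <= i < m) (tvar m i.+1 + tvar m i.+2) *
      subst (qmono m a w) 'X (tvars m i.+2 m.+1) =
    (\sum_(0 <= i < m) (T`_i + T`_i.+1) * Mlist (drop i.+1 T) w) * 'X^a.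
  rewrite mulr_suml; apply: eq_big_nat => i /andP[_ im].
  rewrite tvars_drop; last exact: ltnW.
  rewrite subst_qmono ?size_drop ?size_tvars //; last by lia.
  by rewrite !nth_tvars ?mulrA // ltnW.
rewrite -(@nth_tvars m) // -(@nth_tvars 0) // !mulrA -!mulrDl.
rewrite (@Mlist_recurrence _ T) ?size_tvars // mulrDl mulrnAl -qmonoE.
congr (_ + _); case: w {cw wm} => [|j w]; rewrite qmonoE //.
by rewrite Mlist0 mul1r exprS.
Qed.

(** The factor alpha + t_1 + .. + t_(m+1) gives the first two terms, since the t_i sum to M_1. In
    the remaining sum, substituting t_i for alpha yields t_i^(a+1) M_w(t_1, .., t_(i-1)), where i is
    the largest index. *)
Lemma qsC_qmono a w : composition w -> (size w <= m)%N ->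
  qsC (qmono m a w) = qmono m.+1 a.+1 w
    + \sum_(v <- quasishuffle1 w) qmono m.+1 a v + qmono m.+1 0 (rcons w a.+1).
Proof.
move=> cw wm; rewrite /qsC vext_qmono // !qmonoE.
under [X in _ = _ + X + _]eq_bigr do rewrite qmonoE.
rewrite -mulr_suml -mul_Mlist1 -sum_prefix_Mlist size_tvars Mlist_cons_suffix.
rewrite size_tvars !big_add1 /=.
have -> : \sum_(0 <= i < m.+1) T`_i ^+ 1 * Mlist (drop i.+1 T) [::] =
    \sum_(0 <= i < m.+1) tvar m i.+1.
  apply: eq_big_nat => i /andP[_ im].
  by rewrite Mlist0 mulr1 expr1 nth_tvars.
have -> : \sum_(0 <= i < m.+1) tvar m i.+1 *
      subst (qmono m a w) (tvar m i.+1) (tvars m 1 i) =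
    \sum_(0 <= i < m.+1) T`_i ^+ a.+1 * Mlist (take i T) w.
  apply: eq_big_nat => i /andP[_ im].
  rewrite tvars_take; last exact: ltnW.
  rewrite subst_qmono //; last first.
    by rewrite size_take size_tvars im.
  by rewrite nth_tvars // exprS mulrAC !mulrA.
move: (\sum_(0 <= i < m.+1) _) (\sum_(0 <= i < m.+1) _) => X Y.
rewrite expr0 mulr1 exprS; move: (Mlist _ _) ('X^a) => U V.
move: ('X : {poly _}) => W; ring.
Qed.

End Tvars.

Lemma Mqsym_Mlist m w : Mqsym m w = Mlist [seq 'X_i | i <- enum 'I_m] w.
Proof. exact: sum_sorted_Mlist. Qed.

Lemma qmono_oversize m a w : (m < size w)%N -> qmono m a w = 0.
Proof.
move=> mw; rewrite /qmono Mqsym_Mlist Mlist_oversize ?polyC0 ?mul0r //.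
by rewrite size_map size_enum_ord.
Qed.

(** * Quasi-symmetry of the values of A and C *)

Section QsymA.
Variable m : nat.

Lemma Qsym0 : Qsym (0 : {mpoly int[m]}).
Proof. by exists [::]; rewrite big_nil. Qed.

Lemma QsymD (p q : {mpoly int[m]}) : Qsym p -> Qsym q -> Qsym (p + q).
Proof.
move=> [s [cs ->]] [t [ct ->]]; exists (s ++ t); rewrite big_cat; split=> // x.
by rewrite mem_cat => /orP[/cs|/ct].
Qed.

Lemma QsymMz (p : {mpoly int[m]}) z : Qsym p -> Qsym (p *~ z).
Proof.
move=> [s [cs ->]]; exists [seq (x.1 * z, x.2) | x <- s]; split.
  by move=> _ /mapP[x /cs cx ->].
by rewrite big_map mulrz_suml; apply: eq_bigr => x _; rewrite mulrzA.
Qed.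

Lemma Qsym_Mqsym w : composition w -> Qsym (Mqsym m w).
Proof.
by exists [:: (1, w)]; rewrite big_seq1; split=> // x; rewrite inE => /eqP->.
Qed.

Lemma QsymA0 : QsymA (0 : {poly {mpoly int[m]}}).
Proof. by move=> i; rewrite coef0; exact: Qsym0. Qed.

Lemma QsymAD (g h : {poly {mpoly int[m]}}) : QsymA g -> QsymA h -> QsymA (g + h).
Proof. by move=> Qg Qh i; rewrite coefD; exact: QsymD. Qed.

Lemma QsymAMz (g : {poly {mpoly int[m]}}) z : QsymA g -> QsymA (g *~ z).
Proof.
move=> Qg i; have -> : (g *~ z)`_i = g`_i *~ z by exact: (raddfMz (coefp i)).
exact: QsymMz.
Qed.

Lemma QsymA_qmono a w : composition w -> QsymA (qmono m a w).
Proof.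
move=> cw i; rewrite coefCM coefXn; case: eqP => _; last by rewrite mulr0; exact: Qsym0.
by rewrite mulr1; exact: Qsym_Mqsym.
Qed.

Lemma QsymA_sum (I : eqType) (s : seq I) (F : I -> {poly {mpoly int[m]}}) :
  (forall i, i \in s -> QsymA (F i)) -> QsymA (\sum_(i <- s) F i).
Proof.
move=> QF; rewrite big_seq; apply: (big_ind (@QsymA m)) QF; first exact: QsymA0.
exact: QsymAD.
Qed.

End QsymA.

(* It suffices to look at the alpha^a M_w, and M_w = 0 if w has too many parts. *)
Lemma QsymA_image m n (f : {additive {poly {mpoly int[m]}} -> {poly {mpoly int[n]}}}) :
  (forall a w, composition w -> (size w <= m)%N -> QsymA (f (qmono m a w))) ->
  forall g, QsymA g -> QsymA (f g).
Proof.
move=> Qf g Qg; rewrite -(coefK g) poly_def raddf_sum /=.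
rewrite -(big_mkord xpredT (fun i => f (g`_i *: 'X^i))).
apply: QsymA_sum => i _; have [s [cs ->]] := Qg i.
rewrite -mul_polyC raddf_sum mulr_suml raddf_sum; apply: QsymA_sum => x xs.
rewrite raddfMz /= mulrzAl raddfMz; apply: QsymAMz.
have [wm|mw] := leqP (size x.2) m; first by apply: Qf => //; exact: cs.
by rewrite -/(qmono m i x.2) qmono_oversize // raddf0; exact: QsymA0.
Qed.

Lemma QsymA_qsA m g : QsymA g -> QsymA (@qsA m g).
Proof.
apply: QsymA_image => a w cw wm /=; rewrite qsA_qmono //; apply: QsymAD.
  case: w cw {wm} => [|j w] cw; apply: QsymA_qmono => //.
  by case/andP: cw => _.
by rewrite mulr2n; apply: QsymAD; apply: QsymA_qmono.
Qed.

Lemma composition_quasishuffle1 w v :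
  composition w -> v \in quasishuffle1 w -> composition v.
Proof.
elim: w v => [|j w IHw] v; first by rewrite inE => _ /eqP->.
move=> cjw; have /andP[j0 cw] := cjw; rewrite !inE => /or3P[/eqP->|/eqP->|] //.
by move=> /mapP[u uw ->]; rewrite /= j0 IHw.
Qed.

Lemma QsymA_qsC m g : QsymA g -> QsymA (@qsC m g).
Proof.
apply: QsymA_image => a w cw wm /=; rewrite qsC_qmono //.
apply: QsymAD; last by apply: QsymA_qmono; rewrite /composition all_rcons.
apply: QsymAD; first exact: QsymA_qmono.
by apply: QsymA_sum => v /composition_quasishuffle1 cv; apply/QsymA_qmono/cv.
Qed.

(** * Ranked posets *)

(* [gp_dom] is the set of elements of the poset; the other elements of the
   carrier are irrelevant. The rank of a face is its dimension plus 1. *)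
Record gposet := GPoset {
  gp_sort :> finType;
  gp_dom : {pred gp_sort};
  gp_le : rel gp_sort;
  gp_rk : gp_sort -> nat;
  gp_bot : gp_sort;
  gp_top : gp_sort;
  gp_refl : reflexive gp_le;
  gp_anti : antisymmetric gp_le;
  gp_trans : transitive gp_le;
  gp_bot_dom : gp_bot \in gp_dom;
  gp_top_dom : gp_top \in gp_dom;
  gp_bot_le : {in gp_dom, forall x, gp_le gp_bot x};
  gp_top_le : {in gp_dom, forall x, gp_le x gp_top};
  gp_rk_lt : {in gp_dom &, forall x y,
    gp_le x y -> x != y -> (gp_rk x < gp_rk y)%N};
  gp_rk_pred : {in gp_dom, forall x, (0 < gp_rk x)%N ->
    exists2 y, y \in gp_dom & gp_le y x && (gp_rk y == (gp_rk x).-1)} }.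

Arguments gp_dom : clear implicits.

Definition gp_lt (T : gposet) (x y : T) := gp_le x y && (x != y).

Section GPoset.
Variable T : gposet.
Implicit Types x y : T.

Lemma gp_rk_bot : gp_rk (gp_bot T) = 0%N.
Proof.
have [//|r0] := posnP (gp_rk (gp_bot T)).
have [y yD /andP[yb /eqP yr]] := gp_rk_pred (gp_bot_dom T) r0.
have yE : y = gp_bot T by apply: gp_anti; rewrite yb gp_bot_le.
by move: yr r0; rewrite yE; lia.
Qed.

Lemma gp_rk_gt0 x : x \in gp_dom T -> (0 < gp_rk x)%N = (x != gp_bot T).
Proof.
move=> xD; apply/idP/idP => [|xb]; first by case: eqP => // ->; rewrite gp_rk_bot.
rewrite (leq_trans _ (gp_rk_lt (gp_bot_dom T) xD _ _)) ?gp_bot_le //.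
by rewrite eq_sym.
Qed.

Lemma gp_lt_rk x y : x \in gp_dom T -> y \in gp_dom T -> gp_lt x y ->
  (gp_rk x < gp_rk y)%N.
Proof. by move=> xD yD /andP[]; exact: gp_rk_lt. Qed.

Lemma gp_lt_trans : transitive (@gp_lt T).
Proof.
move=> y x z /andP[xy nxy] /andP[yz nyz]; rewrite /gp_lt (gp_trans xy yz) /=.
by apply: contraNneq nxy => xz; apply/eqP/gp_anti; rewrite xy xz yz.
Qed.

End GPoset.

(** * Sums over chains *)

Section ChainSum.
Variables (T : gposet) (V : zmodType).
Implicit Types (F : nat -> seq nat -> V) (x y : T).

Definition below y : pred T :=
  [pred x | [&& x \in gp_dom T, gp_lt x y & (0 < gp_rk x)%N]].

(* The sum of F(dim x_1, (rk y - rk x_k, .., rk x_2 - rk x_1)) over the chains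
   x_1 < .. < x_k < x_(k+1) = y of elements of positive rank, with k <= n. *)
Fixpoint chsum_rec n F y : V :=
  F (gp_rk y).-1 [::] +
  (if n is n'.+1 then
     \sum_(x | below y x)
       chsum_rec n' (fun a w => F a ((gp_rk y - gp_rk x)%N :: w)) x
   else 0).

Definition chsum F y := chsum_rec (gp_rk y) F y.

(** Ranks drop strictly and stay positive along a chain below y, so it has at most [(gp_rk y).-1]
    members and any larger bound is never reached. *)
Lemma chsum_rec_stable n n' F y : y \in gp_dom T ->
  (gp_rk y <= n.+1)%N -> (gp_rk y <= n'.+1)%N -> chsum_rec n F y = chsum_rec n' F y.
Proof.
have low k x z : z \in gp_dom T -> (gp_rk z <= k.+1)%N -> below z x ->
    (gp_rk x <= k)%N /\ (0 < gp_rk x)%N.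
  move=> zD zk /and3P[xD /(gp_lt_rk xD zD) xz x0]; split=> //.
  by rewrite -ltnS (leq_trans xz).
elim: n n' F y => [|n IHn] [|n'] F y yD yn yn' //=; congr (_ + _).
- by rewrite big1 // => x /(low _ _ _ yD yn)[]; case: (gp_rk x).
- by rewrite big1 // => x /(low _ _ _ yD yn')[]; case: (gp_rk x).
apply: eq_bigr => x yx; have [xD _ _] := and3P yx.
have [xn _] := low _ _ _ yD yn yx; have [xn' _] := low _ _ _ yD yn' yx.
exact: IHn.
Qed.

Lemma chsumE F y : y \in gp_dom T -> chsum F y = F (gp_rk y).-1 [::] +
  \sum_(x | below y x) chsum (fun a w => F a ((gp_rk y - gp_rk x)%N :: w)) x.
Proof.
move=> yD; rewrite /chsum -(@chsum_rec_stable (gp_rk y).+1) ?(leqW (leqnSn _)) //=.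
congr (_ + _); apply: eq_bigr => x /and3P[xD /(gp_lt_rk xD yD) xy _].
by apply: chsum_rec_stable => //; lia.
Qed.

Lemma gp_rk_ind (P : T -> Prop) :
  (forall y, y \in gp_dom T -> (forall x, below y x -> P x) -> P y) ->
  {in gp_dom T, forall y, P y}.
Proof.
move=> IH y; move: {2}(gp_rk y).+1 (ltnSn (gp_rk y)) => n.
elim: n y => // n IHn y yn yD; apply: IH => // x /and3P[xD /(gp_lt_rk xD yD) xy _].
by apply: IHn => //; rewrite -ltnS (leq_trans _ yn).
Qed.

Lemma chsum_rank1 F y : y \in gp_dom T -> gp_rk y = 1%N -> chsum F y = F 0%N [::].
Proof.
move=> yD y1; rewrite chsumE // y1 big1 ?addr0 // => x /and3P[xD yx x0].
by have := leq_ltn_trans x0 (gp_lt_rk xD yD yx); rewrite y1.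
Qed.

(** Gaps of a strict chain are positive and number fewer than [gp_rk y]. This confines attention to
    the words for which [qsA_qmono] and [qsC_qmono] are available. *)
Lemma eq_chsum F F' y : y \in gp_dom T -> (0 < gp_rk y)%N ->
  (forall a w, composition w -> (size w < gp_rk y)%N -> F a w = F' a w) ->
  chsum F y = chsum F' y.
Proof.
move=> yD; move: y yD F F'; apply: gp_rk_ind => y yD IHy F F' y0 eqF.
rewrite !chsumE // eqF //; congr (_ + _); apply: eq_bigr => x yx.
have /and3P[xD /(gp_lt_rk xD yD) xy x0] := yx.
apply: IHy => // a w cw wx; apply: eqF; rewrite /= ?cw ?subn_gt0 ?xy //.
exact: leq_trans xy.
Qed.

Lemma chsumD F F' y : y \in gp_dom T ->
  chsum (fun a w => F a w + F' a w) y = chsum F y + chsum F' y.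
Proof.
move=> yD; move: y yD F F'; apply: gp_rk_ind => y yD IHy F F'.
rewrite !chsumE // addrACA -big_split /=; congr (_ + _).
by apply: eq_bigr => x /IHy->.
Qed.

(* Chains are listed downwards. *)
Definition dchain y (s : seq T) : bool :=
  path (fun u v => gp_lt v u) y s &&
  all (fun x => (x \in gp_dom T) && (0 < gp_rk x)%N) s.

Definition chain_weight F y (s : seq T) : V :=
  F (gp_rk (last y s)).-1 (pairmap subn (gp_rk y) [seq gp_rk x | x <- s]).

Lemma chsum_recE n F y : chsum_rec n F y =
  \sum_(0 <= k < n.+1) \sum_(s : k.-tuple T | dchain y s) chain_weight F y s.
Proof.
elim: n F y => [|n IHn] F y /=.
  by rewrite big_nat1 addr0 (@big_tuple0 _ _ (dchain y)).
rewrite big_nat_recl // (@big_tuple0 _ _ (dchain y)) //; congr (_ + _).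
under [RHS]eq_bigr do rewrite (big_tupleS (dchain y)).
rewrite exchange_big /= big_mkcond; apply: eq_bigr => x _.
case: ifP => [yx|nyx].
  rewrite IHn; apply: eq_bigr => k _; apply: eq_bigl => s.
  by have /and3P[xD xy x0] := yx; rewrite /dchain /= xy xD x0.
rewrite big1 // => k _; rewrite big1 // => s /andP[/= /andP[xy _]].
by rewrite -andbA => /and3P[xD x0 _]; rewrite /below /= xD xy x0 in nyx.
Qed.

End ChainSum.

Lemma raddf_chsum (T : gposet) (V W : zmodType) (f : {additive V -> W})
    (F : nat -> seq nat -> V) (y : T) : y \in gp_dom T ->
  f (chsum F y) = chsum (fun a w => f (F a w)) y.
Proof.
move=> yD; move: y yD F; apply: gp_rk_ind => y yD IHy F.
rewrite !chsumE // raddfD raddf_sum /=; congr (_ + _).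
by apply: eq_bigr => x /IHy->.
Qed.

(** A chain sum sees only the order ideal below y. The two closure hypotheses say that [D] and its
    image under [e] are both closed downwards. *)
Lemma chsum_iso (T T' : gposet) (V : zmodType) (D : {pred T}) (e : T -> T')
    (F : nat -> seq nat -> V) y :
  {subset D <= gp_dom T} ->
  {in D, forall x, e x \in gp_dom T'} ->
  {in D &, injective e} ->
  {in D &, forall x z, gp_le (e x) (e z) = gp_le x z} ->
  {in D, forall x, gp_rk (e x) = gp_rk x} ->
  {in D & gp_dom T, forall x z, gp_le z x -> z \in D} ->
  {in D & gp_dom T', forall x z, gp_le z (e x) -> exists2 u, u \in D & z = e u} ->
  y \in D -> chsum F (e y) = chsum F y.
Proof.
move=> DT DT' einj ele erk Dlow elow yD; have := DT _ yD => yT.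
move: y yT yD F; apply: gp_rk_ind => y yT IHy yD F.
rewrite !chsumE ?DT' ?erk //; congr (_ + _).
rewrite (eq_bigl (mem (e @: [set x in below y]))); last first.
  move=> z; apply/and3P/imsetP => [[zT /andP[zy nzy] z0]|[x]].
    have [u uD zE] := elow _ _ yD zT zy; exists u => //.
    rewrite inE; apply/and3P; rewrite {}zE in zy nzy z0; split; first exact: DT.
      by rewrite /gp_lt -ele // zy; apply: contraNneq nzy => ->.
    by rewrite -erk.
  rewrite inE => /and3P[xT /andP[xy nxy] x0 ->].
  have xD := Dlow _ _ yD xT xy.
  rewrite DT' // erk // /gp_lt ele // xy; split=> //.
  by apply: contraNneq nxy => /einj->.
rewrite big_imset /=; last first.
  move=> x z; rewrite !inE => /and3P[xT /andP[xy _] _] /and3P[zT /andP[zy _] _].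
  exact: einj (Dlow _ _ yD xT xy) (Dlow _ _ yD zT zy).
rewrite big_set /=; apply: eq_bigr => x yx.
have /and3P[xT /andP[xy _] _] := yx; have xD := Dlow _ _ yD xT xy.
by rewrite erk // IHy.
Qed.

(** * Pyramids and bipyramids of posets *)

Section Cone.
Variable T : gposet.
Let C := (T * bool)%type.

Definition cone_dom : {pred C} := [pred p | p.1 \in gp_dom T].
Definition cone_le : rel C := fun p q => gp_le p.1 q.1 && (p.2 ==> q.2).
Definition cone_rk (p : C) : nat := gp_rk p.1 + p.2.

Fact cone_refl : reflexive cone_le.
Proof. by move=> [x s]; rewrite /cone_le /= gp_refl implybb. Qed.

Fact cone_anti : antisymmetric cone_le.
Proof.
move=> [x s] [y t] /andP[/andP[/= xy st] /andP[/= yx ts]].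
congr pair; first by apply: gp_anti; rewrite xy yx.
by case: s t st ts => [] [].
Qed.

Fact cone_trans : transitive cone_le.
Proof.
move=> [y t] [x s] [z u] /andP[/= xy st] /andP[/= yz tu].
rewrite /cone_le /= (gp_trans xy yz); by case: s t u st tu => [] [] [].
Qed.

Fact cone_bot_dom : (gp_bot T, false) \in cone_dom.
Proof. exact: gp_bot_dom. Qed.

Fact cone_top_dom : (gp_top T, true) \in cone_dom.
Proof. exact: gp_top_dom. Qed.

Fact cone_bot_le : {in cone_dom, forall p, cone_le (gp_bot T, false) p}.
Proof. by move=> [x s] xD; rewrite /cone_le /= gp_bot_le. Qed.

Fact cone_top_le : {in cone_dom, forall p, cone_le p (gp_top T, true)}.
Proof. by move=> [x s] xD; rewrite /cone_le /= gp_top_le ?implybT. Qed.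

Fact cone_rk_lt : {in cone_dom &, forall p q,
  cone_le p q -> p != q -> (cone_rk p < cone_rk q)%N}.
Proof.
move=> [x s] [y t]; rewrite !inE /= => xD yD /andP[/= xy st].
rewrite /cone_rk xpair_eqE /=.
have [<-|nxy] := eqVneq x y; first by case: s t st => [] [] //= _ _; lia.
by have := gp_rk_lt xD yD xy nxy; case: s t st => [] [] //=; lia.
Qed.

Fact cone_rk_pred : {in cone_dom, forall p, (0 < cone_rk p)%N ->
  exists2 q, q \in cone_dom & cone_le q p && (cone_rk q == (cone_rk p).-1)}.
Proof.
move=> [x []] xD; rewrite /cone_rk /=.
  by exists (x, false) => //; rewrite /cone_le /= gp_refl addn0 addn1 /=.
rewrite addn0 => x0; have [y yD /andP[yx yr]] := gp_rk_pred xD x0.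
by exists (y, false) => //; rewrite /cone_le /= yx addn0.
Qed.

Definition gcone := GPoset cone_refl cone_anti cone_trans cone_bot_dom
  cone_top_dom cone_bot_le cone_top_le cone_rk_lt cone_rk_pred.

End Cone.

(* The proper elements x of T, each also joined to one of two apexes, and a
   new top element. *)
Section Susp.
Variable T : gposet.
Hypothesis T_gt0 : (0 < gp_rk (gp_top T))%N.
Let B := option (T * option bool).

Definition susp_dom : {pred B} :=
  [pred z | if z is Some (x, _) then (x \in gp_dom T) && (x != gp_top T) else true].
Definition susp_le : rel B := fun z z' =>
  match z, z' with
  | _, None => true
  | None, Some _ => false
  | Some (x, s), Some (y, t) => gp_le x y && ((s == None) || (s == t))
  end.
Definition susp_rk (z : B) : nat :=
  if z is Some (x, s) then gp_rk x + (s != None) else (gp_rk (gp_top T)).+1.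

Fact susp_refl : reflexive susp_le.
Proof. by move=> [[x s]|] //; rewrite /susp_le gp_refl eqxx orbT. Qed.

Fact susp_anti : antisymmetric susp_le.
Proof.
move=> [[x s]|] [[y t]|] //= /andP[/andP[xy st] /andP[yx ts]].
congr (Some (_, _)); first by apply: gp_anti; rewrite xy yx.
by case: s t st ts => [[]|] [[]|].
Qed.

Fact susp_trans : transitive susp_le.
Proof.
move=> [[y t]|] [[x s]|] [[z u]|] //= /andP[xy st] /andP[yz tu].
rewrite (gp_trans xy yz); by case: s t u st tu => [[]|] [[]|] [[]|].
Qed.

Fact susp_bot_dom : Some (gp_bot T, None) \in susp_dom.
Proof.
rewrite inE gp_bot_dom; apply: contraTneq T_gt0 => <-.
by rewrite gp_rk_bot.
Qed.

Fact susp_top_dom : None \in susp_dom.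
Proof. by []. Qed.

Fact susp_bot_le : {in susp_dom, forall z, susp_le (Some (gp_bot T, None)) z}.
Proof. by move=> [[x s]|] //= /andP[xD _]; rewrite gp_bot_le. Qed.

Fact susp_top_le : {in susp_dom, forall z, susp_le z None}.
Proof. by move=> [[x s]|]. Qed.

Fact susp_rk_lt : {in susp_dom &, forall z z',
  susp_le z z' -> z != z' -> (susp_rk z < susp_rk z')%N}.
Proof.
move=> [[x s]|] [[y t]|] //=; last first.
  move=> /andP[xD xt] _ _ _.
  by have := gp_rk_lt xD (gp_top_dom T) (gp_top_le xD) xt; case: (s != None); lia.
move=> /andP[xD _] /andP[yD _] /andP[xy st] ne.
have [yx|nxy] := eqVneq x y.
  by move: ne st; rewrite yx; case: s t => [[]|] [[]|]; rewrite ?eqxx //=; lia.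
by have := gp_rk_lt xD yD xy nxy; case: s t st {ne} => [[]|] [[]|] //=; lia.
Qed.

Fact susp_rk_pred : {in susp_dom, forall z, (0 < susp_rk z)%N ->
  exists2 z', z' \in susp_dom & susp_le z' z && (susp_rk z' == (susp_rk z).-1)}.
Proof.
move=> [[x [b|]]|] /=.
- move=> /andP[xD xt] _; exists (Some (x, None)); first by rewrite inE xD.
  by rewrite /= gp_refl addn0 addn1 /=.
- move=> /andP[xD xt]; rewrite addn0 => x0.
  have [y yD /andP[yx yr]] := gp_rk_pred xD x0.
  exists (Some (y, None)); last by rewrite /= yx addn0.
  rewrite inE yD; apply: contraNneq xt => yt; rewrite -yt.
  by apply/eqP/gp_anti; rewrite yx yt gp_top_le.
move=> _ _; have [y yD /andP[yx /eqP yr]] := gp_rk_pred (gp_top_dom T) T_gt0.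
(* A facet of the suspension is a facet of [T] joined to an apex; either apex serves. *)
exists (Some (y, Some true)); last by rewrite /= yr addn1 prednK.
rewrite inE yD; apply: contraTneq T_gt0 => yt.
by move: yr; rewrite yt; lia.
Qed.

Definition gsusp := GPoset susp_refl susp_anti susp_trans susp_bot_dom
  susp_top_dom susp_bot_le susp_top_le susp_rk_lt susp_rk_pred.

End Susp.

(** * Chain sums of cones and suspensions *)

Section ChainSumCone.
Variables (T : gposet) (V : zmodType).
Implicit Types (F : nat -> seq nat -> V) (x y : T).

Lemma chsum_cone_base F x : x \in gp_dom T ->
  chsum F ((x, false) : gcone T) = chsum F x.
Proof.
move=> xD; apply: (@chsum_iso _ _ _ (gp_dom T) (fun x => (x, false) : gcone T)) => //.
- by move=> u v _ _ [].
- by move=> u v _ _; rewrite /= /cone_le /= andbT.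
- by move=> u _; rewrite /= /cone_rk addn0.
by move=> u [v []] _ vD /andP[//= _ _]; exists v.
Qed.

Lemma big_bool_snd (W : nmodType) (P : pred (T * bool)) (f : T * bool -> W) :
  \sum_(p | P p) f p =
  \sum_(y | P (y, true)) f (y, true) + \sum_(y | P (y, false)) f (y, false).
Proof.
rewrite (bigID (fun p => p.2)) /=; congr (_ + _).
  rewrite (reindex_onto (fun y => (y, true)) fst) => [|[y []] /andP[]] //=.
  by apply: eq_bigl => y; rewrite !andbT eqxx andbT.
rewrite (reindex_onto (fun y => (y, false)) fst) => [|[y []] /andP[]] //=.
by apply: eq_bigl => y; rewrite !andbT eqxx andbT.
Qed.

(* The elements below (x, apex) are the (y, apex) with y < x and the (y, base)
   with y <= x; the sum is organised by the case y = bottom and y = x. *)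
Lemma chsum_cone_apexE F x : x \in gp_dom T -> (0 < gp_rk x)%N ->
  chsum F ((x, true) : gcone T) =
  F (gp_rk x) [::] + F 0%N [:: gp_rk x]
  + \sum_(y | below x y)
      chsum (fun a w => F a ((gp_rk x - gp_rk y)%N :: w)) ((y, true) : gcone T)
  + chsum (fun a w => F a (1%N :: w)) x
  + \sum_(y | below x y) chsum (fun a w => F a ((gp_rk x - gp_rk y).+1 :: w)) y.
Proof.
move=> xD x0; rewrite chsumE // big_bool_snd /= /cone_rk /= addn1 /=.
rewrite [X in _ + (X + _)](bigD1 (gp_bot T)) /=; last first.
  rewrite /below /= inE /= gp_bot_dom /gp_lt /= /cone_le /= gp_bot_le //=.
  by rewrite xpair_eqE andbT eq_sym -gp_rk_gt0 // /cone_rk /= addn1 x0.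
rewrite [X in _ + (_ + X)](bigD1 x) /=; last first.
  rewrite /below /= inE /= xD /gp_lt /= /cone_le /= gp_refl xpair_eqE andbF.
  by rewrite /cone_rk addn0.
rewrite chsum_rank1; [|exact: gp_bot_dom|by rewrite /= /cone_rk /= gp_rk_bot].
rewrite /cone_rk /= gp_rk_bot add0n subn1 -!addrA; congr (_ + (_ + (_ + (_ + _)))).
- apply: eq_big => [y|y _]; last by rewrite addn1 subSS.
  rewrite /below /= /gp_lt /= /cone_le /cone_rk inE /= xpair_eqE !andbT addn1.
  by case: (boolP (y \in _)) => //= yD; rewrite gp_rk_gt0 // !andbT.
- rewrite chsum_cone_base // addn0; apply: eq_chsum => // a w _ _.
  by rewrite subSn ?subnn.
apply: eq_big => [y|y /andP[]].
  rewrite /below /= /gp_lt /= /cone_le /cone_rk inE /= xpair_eqE !andbT !andbF addn0.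
  by rewrite -!andbA; do !bool_congr; rewrite andbC.
rewrite /below /= /gp_lt /= /cone_le inE /= => /and3P[yD /andP[/andP[yx _] _] y0] nyx.
rewrite /cone_rk /= addn0 in y0.
rewrite chsum_cone_base // addn0; apply: eq_chsum => // a w _ _.
by rewrite subSn // ltnW // gp_rk_lt.
Qed.
End ChainSumCone.

Section ChainSumIdentities.
Variables (T : gposet) (V : zmodType).
Implicit Types (F : nat -> seq nat -> V) (x y : T).

(** Going down, a chain of the cone may drop the apex once. If it never does and ends over a
    non-bottom element, only the last dimension grows by one. A drop over a fixed element inserts a
    part 1, and a drop during a strict step enlarges that gap by one. If the chain ends at the apex
    itself, there is a last gap a + 1. *)
Definition coneF F a w : V :=
  F a.+1 w + \sum_(v <- quasishuffle1 w) F a v + F 0%N (rcons w a.+1).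

(* 2C - B on the level of the summands. *)
Definition suspF F a w : V :=
  (if w is j :: w' then F a (j.+1 :: w') else F a.+1 [::]) + F a (1%N :: w) *+ 2.

(** For y strictly below x, the chains continuing at (y, apex) are covered by induction, those
    through (x, base) then (y, base) have gaps [1 :: j], and those going directly to (y, base) have
    gap [j.+1]. This is the recursion of [quasishuffle1]. *)
Theorem chsum_cone F x : x \in gp_dom T -> (0 < gp_rk x)%N ->
  chsum F ((x, true) : gcone T) = chsum (coneF F) x.
Proof.
move=> xD; move: x xD F; apply: gp_rk_ind => x xD IHx F x0.
rewrite chsum_cone_apexE // !(@chsumE T) // {1}/coneF /= big_seq1 prednK //.
rewrite [LHS](AC (3*2*1) ((1*4*2)*(3*5*6))) /=; congr (_ + _).
rewrite -!big_split /=; apply: eq_bigr => y yx.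
have /and3P[yD _ y0] := yx; rewrite IHx // -!chsumD //.
apply: eq_chsum => // a w _ _; rewrite /coneF /= !big_cons big_map.
by rewrite [LHS](AC (3*1*1) ((1*(4*(5*2)))*3)).
Qed.

Hypothesis T_gt0 : (0 < gp_rk (gp_top T))%N.

(** Below a proper element at most one apex occurs, so its ideal is that of a cone. For [s = None]
    no apex occurs, and the choice [b = true] is arbitrary. *)
Lemma chsum_susp_proper F x s : x \in gp_dom T -> x != gp_top T ->
  chsum F (Some (x, s) : gsusp T_gt0) = chsum F ((x, s != None) : gcone T).
Proof.
move=> xD xt.
pose b := odflt true s.
rewrite (_ : s = if s != None then Some b else None); last by case: (s) @b.
have -> : (if s != None then Some b else None) != None = (s != None) by case: (s).
pose e (p : gcone T) : gsusp T_gt0 := Some (p.1, if p.2 then Some b else None).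
pose D : {pred gcone T} := [pred p | (p.1 \in gp_dom T) && (p.1 != gp_top T)].
apply: (@chsum_iso _ _ _ D e F (x, s != None)).
- by move=> p /andP[].
- by move=> p.
- by move=> [u [] ] [v []] _ _ [] //= ->.
- by move=> [u c] [v d] _ _; rewrite /= /cone_le /=; case: c d => [] [] /=; rewrite ?eqxx.
- by move=> [u []] _.
- move=> [u c] [v d] /andP[/= uD ut] vD /andP[/= vu _]; apply/andP; split=> //=.
  apply: contraNneq ut => vt; apply/eqP/gp_anti.
  by rewrite gp_top_le // -vt vu.
- move=> [u c] [[v d]|] //= /andP[/= uD ut] /andP[vD vt] /andP[vu dc].
  exists (v, d != None); first exact/andP.
  by rewrite /e /=; case: d c dc => [d|] [] //= /eqP[->].
by apply/andP.
Qed.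

Let susp_part (s : option bool) (z : gsusp T_gt0) : bool :=
  if z is Some (_, s') then s' == s else false.

Lemma sum_susp_part (P : pred (gsusp T_gt0)) (f : gsusp T_gt0 -> V) s :
  \sum_(z | P z && susp_part s z) f z =
  \sum_(y | P (Some (y, s))) f (Some (y, s)).
Proof.
rewrite (reindex_onto (fun y => Some (y, s) : gsusp T_gt0)
  (fun z => if z is Some (y, _) then y else gp_bot T)) => [|[[y t]|]] /=.
- by apply: eq_bigl => y; rewrite !eqxx !andbT.
- by move=> /andP[_ /eqP->].
- by rewrite andbF.
Qed.

Lemma below_susp_top y s : below (None : gsusp T_gt0) (Some (y, s)) =
  [&& y \in gp_dom T, y != gp_top T & (0 < gp_rk y + (s != None))%N].
Proof. by rewrite /below /= inE /= -andbA. Qed.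

Lemma below_top y :
  below (gp_top T) y = [&& y \in gp_dom T, y != gp_top T & (0 < gp_rk y)%N].
Proof.
by rewrite /below /= /gp_lt; case: (boolP (y \in _)) => // /gp_top_le->.
Qed.

(** The elements below the new top are sorted by their apex. Those without one have gaps enlarged by
    one, since the top has gained a rank; the two apexes contribute equally, and the bottom element
    joined to an apex is that apex alone. *)
Lemma chsum_susp_topE F :
  chsum F (None : gsusp T_gt0) = F (gp_rk (gp_top T)) [::]
  + \sum_(y | below (gp_top T) y)
      chsum (fun a w => F a ((gp_rk (gp_top T) - gp_rk y).+1 :: w)) y
  + (F 0%N [:: gp_rk (gp_top T)] + \sum_(y | below (gp_top T) y)
      chsum (fun a w => F a ((gp_rk (gp_top T) - gp_rk y)%N :: w))
        ((y, true) : gcone T)) *+ 2.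
Proof.
have tD := gp_top_dom T; set t := gp_top T.
have bt : gp_bot T != t by rewrite eq_sym -gp_rk_gt0.
rewrite chsumE // -addrA; congr (_ + _).
rewrite (bigID (susp_part None)) sum_susp_part; congr (_ + _).
  apply: eq_big => [y|y]; first by rewrite below_susp_top addn0 below_top.
  rewrite below_susp_top addn0 => /and3P[yD yt y0].
  rewrite chsum_susp_proper // chsum_cone_base //; apply: eq_chsum => // a w _ _.
  by rewrite /= addn0 subSn // ltnW // gp_rk_lt // gp_top_le.
rewrite (bigID (susp_part (Some true))) mulr2n.
have part b : \sum_(z | below (None : gsusp T_gt0) z && susp_part (Some b) z)
    chsum (fun a w => F a ((gp_rk (None : gsusp T_gt0) - gp_rk z)%N :: w)) z =
    F 0%N [:: gp_rk t] + \sum_(y | below t y)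
      chsum (fun a w => F a ((gp_rk t - gp_rk y)%N :: w)) ((y, true) : gcone T).
  rewrite sum_susp_part (bigD1 (gp_bot T)) /=; last first.
    by rewrite below_susp_top gp_bot_dom bt addn1.
  rewrite addn1 gp_rk_bot subSS subn0; congr (_ + _).
    rewrite chsum_rank1 //; first by rewrite inE /= gp_bot_dom bt.
    by rewrite /= gp_rk_bot.
  apply: eq_big => [y|y].
    rewrite below_susp_top below_top addn1.
    by case: (boolP (y \in _)) => //= yD; rewrite gp_rk_gt0 // andbT.
  rewrite below_susp_top => /andP[/and3P[yD yt _] _].
  by rewrite chsum_susp_proper // addn1 subSS.
congr (_ + _).
  rewrite -[RHS](part true); apply: eq_bigl => -[[y [[]|]]|] /=; by rewrite ?andbT ?andbF.
rewrite -[RHS](part false); apply: eq_bigl => -[[y [[]|]]|] /=; by rewrite ?andbT ?andbF.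
Qed.

(** Besides one copy of the chains that drop the apex at their first strict step, what remains of
    the doubled cone is two copies of the chains through its base: the base is a face of the pyramid
    but not of the bipyramid. *)
Theorem chsum_susp F :
  chsum F ((gp_top T, true) : gcone T) *+ 2 - chsum F (None : gsusp T_gt0) =
  chsum (suspF F) (gp_top T).
Proof.
have tD := gp_top_dom T.
rewrite chsum_cone_apexE // chsum_susp_topE.
have -> : chsum (suspF F) (gp_top T) = F (gp_rk (gp_top T)) [::]
  + \sum_(y | below (gp_top T) y)
      chsum (fun a w => F a ((gp_rk (gp_top T) - gp_rk y).+1 :: w)) y
  + chsum (fun a w => F a (1%N :: w)) (gp_top T) *+ 2.
  rewrite !(@chsumE T) // {1}/suspF /= prednK // mulrnDl.
  rewrite [in RHS]addrACA; congr (_ + _).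
  rewrite -sumrMnl -big_split; apply: eq_bigr => y /and3P[yD _ y0] /=.
  rewrite mulr2n -!chsumD //; apply: eq_chsum => // a w _ _.
rewrite [X in X *+ 2](AC 5 ((1*5)*(2*3)*4)) /=.
set P := F _ [::] + _; set Q := F _ [:: _] + _; set S := chsum _ _.
apply/eqP; rewrite mulrnDl (mulrnDl _ P) subr_eq {1}[P *+ 2]mulr2n; apply/eqP.
by rewrite [LHS](AC (2*1*1) ((1*4)*(2*3))).
Qed.
End ChainSumIdentities.

(** * The face lattice of a polytope *)

Section FaceLattice.
Variables (R : realType) (d : nat).
Implicit Types (x : 'rV[R]_d) (h : 'cV[R]_(d + 1)).

(* Affine functionals on R^d are linear functionals of (x, 1). *)
Definition hpt x : 'rV[R]_(d + 1) := row_mx x 1.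
Definition hval h x : R := (hpt x *m h) 0 0.

Lemma hvalE (c : 'cV[R]_d) (b : R) x :
  hval (col_mx c b%:M) x = (x *m c) 0 0 + b.
Proof. by rewrite /hval mul_row_col mul1mx !mxE eqxx mulr1n. Qed.

Lemma hvalD h g x : hval (h + g) x = hval h x + hval g x.
Proof. by rewrite /hval mulmxDr mxE. Qed.

Lemma hvalZ (a : R) h x : hval (a *: h) x = a * hval h x.
Proof. by rewrite /hval -scalemxAr mxE. Qed.

Lemma hval0 x : hval 0 x = 0.
Proof. by rewrite /hval mulmx0 mxE. Qed.

Lemma hpt_sum (I : finType) (w : I -> R) (p : I -> 'rV[R]_d) :
  \sum_i w i *: hpt (p i) =
  row_mx (\sum_i w i *: p i) (\sum_i w i)%:M.
Proof.
rewrite -[LHS]hsubmxK !linear_sum /=; congr row_mx.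
  by apply: eq_bigr => i _; rewrite linearZ /= row_mxKl.
by rewrite raddf_sum; apply: eq_bigr => i _; rewrite linearZ /= row_mxKr scalemx1.
Qed.

Lemma hval_sum (I : finType) (w : I -> R) (p : I -> 'rV[R]_d) h : \sum_i w i = 1 ->
  hval h (\sum_i w i *: p i) = \sum_i w i * hval h (p i).
Proof.
move=> w1; rewrite /hval {1}/hpt.
have -> : row_mx (\sum_i w i *: p i) 1 = \sum_i w i *: hpt (p i).
  by rewrite hpt_sum w1.
rewrite mulmx_suml summxE; apply: eq_bigr => i _.
by rewrite -scalemxAl mxE.
Qed.

Variables (I : finType) (u : I -> 'rV[R]_d).
Implicit Types J K : {set I}.

Definition exposes h J :=
  forall i, 0 <= hval h (u i) /\ (i \in J) = (hval h (u i) == 0).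

(* A face of conv(u) is encoded by the set of the indices i with u i on it. *)
Definition iface : {pred {set I}} := fun J => `[< exists h, exposes h J >].

Definition cset J : set 'rV[R]_d :=
  [set x | exists w : I -> R, [/\ forall i, 0 <= w i, \sum_i w i = 1,
     forall i, i \notin J -> w i = 0 & x = \sum_i w i *: u i]].

Lemma cset_gen J i : i \in J -> cset J (u i).
Proof.
move=> iJ; exists (fun j => (j == i)%:R); split=> [j||j|].
- exact: ler0n.
- by rewrite (bigD1 i) //= eqxx big1 ?addr0 // => j /negPf->.
- by case: eqP => // ->; rewrite iJ.
by rewrite (bigD1 i) //= eqxx scale1r big1 ?addr0 // => j /negPf->; rewrite scale0r.
Qed.

Lemma csetS J K : J \subset K -> cset J `<=` cset K.
Proof.
move=> /fintype.subsetP JK x [w [w0 w1 wJ ->]]; exists w; split=> // i iK.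
by apply: wJ; apply: contra iK; exact: JK.
Qed.

(** A convex combination of value zero is a vanishing sum of nonnegative terms, so no weight lies
    outside [J]. *)
Lemma cset_exposed h J : exposes h J ->
  cset J = [set x | cset [set: I] x /\ hval h x = 0].
Proof.
move=> hJ; apply/seteqP; split=> x [].
  move=> w [w0 w1 wJ ->]; split; first by exists w; split=> // i; rewrite inE.
  rewrite hval_sum // big1 // => i _; have [_ iJ] := hJ i.
  by case: (boolP (i \in J)) => [|/wJ->]; rewrite ?mul0r // iJ => /eqP->; rewrite mulr0.
move=> [w [w0 w1 _ ->]]; rewrite hval_sum // => /eqP.
rewrite psumr_eq0 => [|i _]; last by rewrite mulr_ge0 //; case: (hJ i).
move=> /allP wh; exists w; split=> // i iJ; have [_ iE] := hJ i.
have /wh : i \in index_enum I by rewrite mem_index_enum.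
by rewrite mulf_eq0 -iE (negPf iJ) orbF => /eqP.
Qed.

Lemma cset_le J K : K \in iface -> (cset J `<=` cset K) <-> (J \subset K).
Proof.
move=> /asboolP[h hK]; split; last exact: csetS.
move=> JK; apply/fintype.subsetP => i iJ; have /JK := cset_gen iJ.
by rewrite (cset_exposed hK) => -[_ /eqP]; have [_ ->] := hK i.
Qed.

Lemma face_csetP F :
  face (cset [set: I]) F <-> exists2 J, J \in iface & F = cset J.
Proof.
split=> [[c [b [cb ->]]]|[J /asboolP[h hJ] ->]].
  (* The valid inequality becomes the nonnegative functional b - x c, with the same equality set. *)
  pose h := col_mx (- c) b%:M.
  have hE x : hval h x = b - (x *m c) 0 0 by rewrite hvalE mulmxN mxE addrC.
  have hJ : exposes h [set i | hval h (u i) == 0].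
    move=> i; rewrite inE hE subr_ge0; split=> //; apply: cb; exact: cset_gen.
  exists [set i | hval h (u i) == 0]%SET; first by apply/asboolP; exists h.
  rewrite (cset_exposed hJ); apply/seteqP; split=> x /= [xS]; rewrite hE.
    by move=> ->; rewrite subrr.
  by move=> /eqP; rewrite subr_eq0 => /eqP.
rewrite (cset_exposed hJ); exists (- usubmx h), (dsubmx h 0 0).
have hE x : hval h x = dsubmx h 0 0 - (x *m - usubmx h) 0 0.
  rewrite (_ : (x *m - usubmx h) 0 0 = - (x *m usubmx h) 0 0); last first.
    by rewrite mulmxN mxE.
  rewrite opprK addrC -hvalE; congr (hval _ x).
  by rewrite -[LHS]vsubmxK -mx11_scalar.
split=> [x [w [w0 w1 _ ->]]|].
  rewrite -subr_ge0 -hE hval_sum // sumr_ge0 // => i _.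
  by rewrite mulr_ge0 //; case: (hJ i).
apply/seteqP; split=> x /= [xS]; rewrite hE.
  by move=> /eqP; rewrite subr_eq0 => /eqP.
by move=> ->; rewrite subrr.
Qed.

Definition ispan J : 'M[R]_(d + 1) := (\sum_(i in J) <<hpt (u i)>>)%MS.
Definition irank J : nat := \rank (ispan J).

Lemma hpt_ispan J i : i \in J -> (hpt (u i) <= ispan J)%MS.
Proof. by move=> iJ; rewrite (sumsmx_sup i) // genmxE. Qed.

Lemma ispan_sub J m (A : 'M_(m, d + 1)) :
  reflect (forall i, i \in J -> (hpt (u i) <= A)%MS) (ispan J <= A)%MS.
Proof.
apply: (iffP sumsmx_subP) => H i /H; by rewrite genmxE.
Qed.

Lemma hval_ispan h J : (forall i, i \in J -> hval h (u i) = 0) -> ispan J *m h = 0.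
Proof.
move=> hJ; apply/eqP; rewrite -sub_kermx; apply/ispan_sub => i /hJ hi.
by rewrite sub_kermx; apply/eqP/matrixP => a b; rewrite !ord1 [RHS]mxE; exact: hi.
Qed.

(** With equal ranks both sets would span the same space, so the functional exposing [J] would
    vanish on [K] and force [K] into [J]. *)
Lemma irank_lt : {in iface &, forall J K, J \subset K -> J != K ->
  (irank J < irank K)%N}.
Proof.
move=> J K /asboolP[h hJ] _ sJK nJK.
have JK : (ispan J <= ispan K)%MS.
  by apply/ispan_sub => i /(fintype.subsetP sJK)/hpt_ispan.
rewrite ltn_neqAle mxrankS // andbT; apply: contra nJK => rJK.
rewrite finset.eqEsubset sJK; apply/fintype.subsetP => i iK.
have KJ : (ispan K <= ispan J)%MS by rewrite -(mxrank_leqif_sup JK).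
have /submxP[a aE] := submx_trans (hpt_ispan iK) KJ.
have [_ ->] := hJ i; rewrite /hval aE -mulmxA hval_ispan ?mulmx0 ?mxE // => j.
by have [_ ->] := hJ j => /eqP.
Qed.

Lemma iface0 : finset.set0 \in iface.
Proof.
apply/asboolP; exists (col_mx 0 1%:M) => i.
by rewrite hvalE mulmx0 mxE add0r ler01 inE oner_eq0.
Qed.

Lemma ifaceT : [set: I]%SET \in iface.
Proof. by apply/asboolP; exists 0 => i; rewrite hval0 inE eqxx. Qed.

(* A face of a face is a face: add a large multiple of the functional exposing
   the bigger one. *)
Lemma iface_trans J h : J \in iface -> (forall i, i \in J -> 0 <= hval h (u i)) ->
  [set i in J | hval h (u i) == 0]%SET \in iface.
Proof.
move=> /asboolP[g gJ] h0.
(* All summands are nonnegative, so [N] dominates each of them; the added 1 makes [N *: g + h]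
   strictly positive outside [J]. *)
pose N := \sum_(i in ~: J) (`|hval h (u i)| + 1) / hval g (u i).
have g0 i : 0 <= hval g (u i) by case: (gJ i).
have gP i : i \notin J -> 0 < hval g (u i).
  by have [gi ->] := gJ i; rewrite lt_def gi andbT.
apply/asboolP; exists (N *: g + h) => i; rewrite hvalD hvalZ inE.
case: (boolP (i \in J)) => iJ /=.
  have [_] := gJ i; rewrite iJ => /esym/eqP->.
  by rewrite mulr0 add0r h0.
have lt0 : 0 < N * hval g (u i) + hval h (u i).
  have : (`|hval h (u i)| + 1) / hval g (u i) <= N.
    rewrite /N (bigD1 i) ?inE //= lerDl sumr_ge0 // => j _.
    by rewrite divr_ge0 // addr_ge0.
  rewrite ler_pdivrMr ?gP // => le.
  have := ler_norm (- hval h (u i)); rewrite normrN; lra.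
by rewrite (ltW lt0) gt_eqF.
Qed.

(* A maximal proper subface K of J has rank one less than J: otherwise some
   functional g vanishes on K and on a further point of J, but not on J, and
   tilting g by the functional h that exposes K until it is nonnegative on J
   exposes a proper subface larger than K. *)
Lemma iface_pred J : J \in iface -> (0 < irank J)%N ->
  exists2 K, K \in iface & (K \subset J) && (irank K == (irank J).-1).
Proof.
move=> fJ J0.
have nJ : finset.set0 \proper J.
  rewrite proper0; apply: contraTneq J0 => ->.
  by rewrite /irank /ispan big_set0 mxrank0.
pose P := [pred K | (K \in iface) && (K \proper J)].
have P0 : P finset.set0 by rewrite /= iface0.
case: (arg_maxnP (fun K : {set I} => #|K|) P0) => K /andP[fK KJ] Kmax.
have KsJ := proper_sub KJ.
have rKJ : (irank K < irank J)%N.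
  by rewrite irank_lt // proper_neq.
exists K => //; rewrite KsJ; apply: contraT => rK.
have {rK}rK : (irank K + 1 < irank J)%N by move/eqP: rK; lia.
have [h hK] := asboolP _ fK.
have [_ [i0 i0J i0K]] := properP KJ.
(* [W] has rank at most [irank K + 1], which is below [irank J], so some j of [J] escapes it. *)
pose W := (ispan K + <<hpt (u i0)>>)%MS.
have [j jJ jW] : exists2 j, j \in J & ~~ (hpt (u j) <= W)%MS.
  have : ~~ (ispan J <= W)%MS.
    apply: contraL rK => /mxrankS JW; rewrite -leqNgt (leq_trans JW) //.
    by rewrite (leq_trans (mxrank_adds_leqif _ _)) // leq_add2l genmxE rank_leq_row.
  case: ispan_sub => // nsub _; apply: contrapT => nex; apply: nsub => i iJ.
  by apply: contraT => iW; case: nex; exists i.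
(* A column of the cokernel of [W] vanishes on [W] but not at j; scaling it by minus its value at j
   makes that value negative. *)
have [g [gK gi0 gj]] : exists g, [/\ forall i, i \in K -> hval g (u i) = 0,
    hval g (u i0) = 0 & hval g (u j) < 0].
  have [k kj] : exists k, (hpt (u j) *m cokermx W) 0 k != 0.
    by move: jW; rewrite submxE => /rV0Pn.
  have cE x : hval (col k (cokermx W)) x = (hpt x *m cokermx W) 0 k.
    rewrite /hval [LHS]mxE [RHS]mxE; apply: eq_bigr => l _.
    by rewrite [col _ _ _ _]mxE.
  have c0 x : (hpt x <= W)%MS -> hval (col k (cokermx W)) x = 0.
    by rewrite submxE cE => /eqP->; rewrite mxE.
  pose c := - hval (col k (cokermx W)) (u j).
  exists (c *: col k (cokermx W)); split=> [i iK||]; rewrite hvalZ.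
  - by rewrite c0 ?mulr0 // (submx_trans (hpt_ispan iK)) // addsmxSl.
  - by rewrite c0 ?mulr0 // (submx_trans _ (addsmxSr _ _)) // genmxE.
  by rewrite /c mulNr -expr2 oppr_lt0 exprn_even_gt0 //= cE.
have hP i : i \notin K -> 0 < hval h (u i).
  by have [hi ->] := hK i; rewrite lt_def hi andbT.
have h0 i : i \in K -> hval h (u i) = 0.
  by have [_ ->] := hK i => /eqP.
have jK : j \notin K by apply: contraTN gj => /gK->; rewrite ltxx.
(* Subtracting the least ratio times h keeps the functional nonnegative on [J] and makes it vanish
   at the minimiser i1. That ratio is negative because of j, so the value at i0, where g is zero,
   stays positive. *)
pose r i := hval g (u i) / hval h (u i).
have j0 : j \in J :\: K by rewrite inE jK.
case: (@arg_minP _ _ _ j (mem (J :\: K)) r j0) => i1 i1JK r1.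
have /andP[i1K i1J] : (i1 \notin K) && (i1 \in J) by rewrite -finset.in_setD.
have r_lt0 : r i1 < 0.
  by rewrite (le_lt_trans (r1 _ j0)) // pmulr_llt0 // invr_gt0 hP.
pose f := g - r i1 *: h.
have fE i : hval f (u i) = hval g (u i) - r i1 * hval h (u i).
  by rewrite /f -scaleNr hvalD hvalZ mulNr.
have f0 i : i \in J -> 0 <= hval f (u i).
  move=> iJ; rewrite fE; case: (boolP (i \in K)) => iK.
    by rewrite gK // h0 // mulr0 subr0.
  have iJK : i \in J :\: K by rewrite finset.in_setD iK.
  by rewrite subr_ge0 -ler_pdivlMr ?hP //; exact: r1.
have fi1 : hval f (u i1) = 0.
  by rewrite fE /r divfK ?subrr // gt_eqF // hP.
have fi0 : 0 < hval f (u i0).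
  by rewrite fE gi0 sub0r -mulNr mulr_gt0 ?hP // oppr_gt0.
pose K' := [set i in J | hval f (u i) == 0]%SET.
have fK' : P K'.
  apply/andP; split; first exact: iface_trans.
  rewrite properE; apply/andP; split.
    by apply/fintype.subsetP => i; rewrite inE => /andP[].
  by apply/subsetPn; exists i0 => //; rewrite inE i0J gt_eqF.
have /= := Kmax _ fK'; rewrite leqNgt proper_card // properE; apply/andP; split.
  apply/fintype.subsetP => i iK.
  by rewrite inE (fintype.subsetP KsJ) // fE gK // h0 // mulr0 subr0 eqxx.
by apply/subsetPn; exists i1 => //; rewrite inE i1J fi1 eqxx.
Qed.

Lemma hpt_cset J x : cset J x -> (hpt x <= ispan J)%MS.
Proof.
move=> [w [_ w1 wJ ->]].
have -> : hpt (\sum_i w i *: u i) = \sum_i w i *: hpt (u i).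
  by rewrite hpt_sum w1.
apply: summx_sub => i _; case: (boolP (i \in J)) => [iJ|/wJ->].
  by rewrite scalemx_sub // hpt_ispan.
by rewrite scale0r sub0mx.
Qed.

Lemma affinely_independent_free k (p : 'I_k -> 'rV[R]_d) :
  affinely_independent p <-> row_free (\matrix_i hpt (p i)).
Proof.
have E (v : 'rV[R]_k) : v *m (\matrix_i hpt (p i)) =
    row_mx (\sum_i v 0 i *: p i) (\sum_i v 0 i)%:M.
  rewrite mulmx_sum_row -hpt_sum; apply: eq_bigr => i _.
  by rewrite rowK.
split=> [ind|free w w0 wp i].
  apply: inj_row_free => v; rewrite E -[0 in RHS]row_mx0 => /eq_row_mx[vp].
  move=> /matrixP/(_ 0 0); rewrite !mxE eqxx mulr1n => v0.
  by apply/rowP => i; rewrite mxE; exact: ind.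
pose v := \row_i w i.
suff : v == 0 by move=> /eqP/rowP/(_ i); rewrite !mxE.
rewrite -(mulmx_free_eq0 v free) E.
have -> : \sum_i v 0 i *: p i = 0.
  by rewrite -[RHS]wp; apply: eq_bigr => l _; rewrite mxE.
have -> : \sum_i v 0 i = 0 by rewrite -[RHS]w0; apply: eq_bigr => l _; rewrite mxE.
by rewrite raddf0 row_mx0.
Qed.

(** Affinely independent points of the hull homogenise to free rows inside [ispan J]; conversely a
    maximal free family of generators attains the rank. *)
Lemma affine_dim_cset J : affine_dim (cset J) = (irank J)%:Z - 1.
Proof.
rewrite /affine_dim; congr (Posz _ - 1); apply/eqP; rewrite eqn_leq.
apply/andP; split.
  apply/bigmax_leqP => k /asboolP[p pJ /affinely_independent_free /eqP<-].
  apply: mxrankS; apply/row_subP => i; rewrite rowK; exact: hpt_cset.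
pose M := \matrix_(i < #|J|) hpt (u (enum_val i)).
have ME : (M :=: ispan J)%MS.
  apply/eqmxP/andP; split.
    by apply/row_subP => i; rewrite rowK hpt_ispan // enum_valP.
  apply/ispan_sub => i iJ.
  by rewrite (_ : hpt (u i) = row (enum_rank_in iJ i) M) ?row_sub // rowK enum_rankK_in.
rewrite /irank -ME.
(* The rank is at most d + 1, within the range of the maximum in [affine_dim]. *)
have rd : (\rank M < d.+2)%N by rewrite ltnS (leq_trans (rank_leq_col M)) ?addn1.
apply: (leq_bigmax_cond (Ordinal rd)); apply/asboolP => /=.
exists (fun i => u (enum_val (maxrankfun M i))).
  by move=> i; apply: cset_gen; exact: enum_valP.
apply/affinely_independent_free.
suff <- : rowsub (maxrankfun M) M = \matrix_i hpt (u (enum_val (maxrankfun M i))).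
  exact: maxrowsub_free.
by apply/row_matrixP => i; rewrite row_rowsub !rowK.
Qed.

Fact face_poset_bot_le : {in iface, forall J, finset.set0 \subset J}.
Proof. by move=> J _; exact: finset.sub0set. Qed.

Fact face_poset_top_le : {in iface, forall J : {set I}, J \subset [set: I]%SET}.
Proof. by move=> J _; exact: finset.subsetT. Qed.

Fact face_poset_anti : antisymmetric (fun J K : {set I} => J \subset K).
Proof. by move=> J K /andP[JK KJ]; apply/eqP; rewrite finset.eqEsubset JK. Qed.

Fact face_poset_trans : transitive (fun J K : {set I} => J \subset K).
Proof. by move=> J K L; exact: fintype.subset_trans. Qed.

Definition face_poset := @GPoset {set I} iface (fun J K => J \subset K) irank
  finset.set0 [set: I]%SET (fun J => subxx J) face_poset_anti face_poset_trans
  iface0 ifaceT face_poset_bot_le face_poset_top_le irank_lt iface_pred.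

End FaceLattice.

(** * Posets modelling the face lattice *)

(** Antisymmetry makes [phi] injective on [gp_dom T]. Ranks are deliberately absent: dimensions are
    to be recovered from the order alone. *)
Definition models (R : realType) (T : gposet) d (S : set 'rV[R]_d)
    (phi : T -> set 'rV[R]_d) : Prop :=
  [/\ {in gp_dom T, forall x, face S (phi x)},
      forall F, face S F -> exists2 x, x \in gp_dom T & phi x = F &
      {in gp_dom T &, forall x y, phi x `<=` phi y <-> gp_le x y}].

Section Models.
Variable R : realType.

Lemma models_rk_le (T T' : gposet) d (S : set 'rV[R]_d) phi phi' :
  models (T := T) S phi -> models (T := T') S phi' ->
  {in gp_dom T & gp_dom T', forall x x', phi x = phi' x' -> (gp_rk x <= gp_rk x')%N}.
Proof.
move=> [fS _ phi_le] [_ onto phi'_le] x x'; have [n] := ubnP (gp_rk x).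
elim: n x x' => // n IHn x x' xn xD x'D xx'.
have [->//|x0] := posnP (gp_rk x).
have [y yD /andP[yx /eqP yr]] := gp_rk_pred xD x0.
have nyx : y != x by apply: contraTneq x0 => yE; rewrite yE in yr; lia.
have [y' y'D y'E] := onto _ (fS _ yD).
have y'x' : gp_le y' x' by apply/phi'_le => //; rewrite y'E -xx'; apply/phi_le.
have ny'x' : y' != x'.
  apply: contraNneq nyx => y'x'E; apply/eqP/gp_anti/andP; split=> //.
  by apply/phi_le => //; rewrite xx' -y'x'E y'E.
have yy' : (gp_rk y <= gp_rk y')%N by apply: IHn => //; lia.
by have := gp_rk_lt y'D x'D y'x' ny'x'; lia.
Qed.

Lemma models_face_poset d (I : finType) (u : I -> 'rV[R]_d) :
  models (T := face_poset u) (cset u [set: I]) (cset u).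
Proof.
split=> [J JD|F /face_csetP[J JD ->]|J K _ KD]; last exact: cset_le.
  by apply/face_csetP; exists J.
by exists J.
Qed.

(** Ranks in [face_poset u] come from linear algebra; comparing with that model in both directions
    carries them to any other model. *)
Lemma models_dim d (I : finType) (u : I -> 'rV[R]_d) (T : gposet) phi :
  models (T := T) (cset u [set: I]) phi ->
  {in gp_dom T, forall x, affine_dim (phi x) = (gp_rk x)%:Z - 1}.
Proof.
move=> mod x xD; have modu := models_face_poset u; have [fS _ _] := mod.
have [_ onto _] := modu; have [J JD JE] := onto _ (fS _ xD).
rewrite -JE affine_dim_cset; congr (Posz _ - 1); apply/eqP; rewrite eqn_leq.
by rewrite (models_rk_le modu mod JD xD JE) (models_rk_le mod modu xD JD).
Qed.

Lemma models_code d (I : finType) (u : I -> 'rV[R]_d) (T : gposet)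
    (code : T -> {set I}) :
  {in gp_dom T, forall x, code x \in iface u} ->
  (forall K, K \in iface u -> exists2 x, x \in gp_dom T & code x = K) ->
  {in gp_dom T &, forall x y, (code x \subset code y) = gp_le x y} ->
  models (T := T) (cset u [set: I]) (cset u \o code).
Proof.
move=> codeI onto code_le; split=> [x xD|F /face_csetP[K /onto[x xD <-] ->]|x y xD yD].
- by apply/face_csetP; exists (code x) => //; exact: codeI.
- by exists x.
by rewrite -code_le //; apply: cset_le; exact: codeI.
Qed.

Lemma models_comb_equivalent (P Q : polytope R) (T : gposet) phi :
  comb_equivalent P Q -> models (T := T) (@pset R P) phi ->
  exists phi', models (T := T) (@pset R Q) phi'.
Proof.
move=> [psi [[psiF _ psi_onto] psi_le]] [fS onto phi_le]; exists (psi \o phi).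
split=> [x xD|F fF|x y xD yD] /=.
- by apply: psiF; exact: fS.
- have [G /onto[x xD <-] <-] := psi_onto _ fF; by exists x.
by rewrite -psi_le; [exact: phi_le|exact: fS|exact: fS].
Qed.

Lemma conv_hull_cset d (V : seq 'rV[R]_d) (I : finType) (u : I -> 'rV[R]_d)
    (e : I -> 'I_(size V)) : bijective e -> (forall i, V`_(e i) = u i) ->
  conv_hull V = cset u [set: I].
Proof.
move=> [e' eK e'K] eu; apply/seteqP; split=> x.
  move=> [w [w0 w1 ->]]; exists (w \o e); split=> [i||i|] /=; first exact: w0.
  - by rewrite -w1 [RHS](reindex e) //; exists e' => ? _.
  - by rewrite inE.
  by rewrite [LHS](reindex e); [apply: eq_bigr => i _; rewrite eu|exists e' => ? _].
move=> [w [w0 w1 _ ->]]; exists (w \o e'); split=> [i||] /=; first exact: w0.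
  by rewrite -w1 [RHS](reindex e') //; exists e => ? _.
rewrite [LHS](reindex e'); last by exists e => ? _.
by apply: eq_bigr => i _; rewrite -eu e'K.
Qed.

Definition gen (P : polytope R) (i : 'I_(size (generators P))) : 'rV[R]_(ambient P) :=
  (generators P)`_i.

Lemma pset_cset (P : polytope R) :
  @pset R P = cset (@gen P) [set: 'I_(size (generators P))].
Proof. by apply: (@conv_hull_cset _ _ _ _ id) => //; exists id. Qed.

End Models.

(** * Faces of pyramids and bipyramids *)

Section PyramidFaces.
Variables (R : realType) (d : nat) (I : finType) (u : I -> 'rV[R]_d).

(* An affine functional on R^(d + 1) with slope [a] in the last direction. *)
Definition hlift (g : 'cV[R]_(d + 1)) (a : R) : 'cV[R]_(d + 1 + 1) :=
  col_mx (col_mx (usubmx g) a%:M) (dsubmx g).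

Lemma hval_hlift g a v (k : 'rV[R]_1) :
  hval (hlift g a) (row_mx v k) = hval g v + k 0 0 * a.
Proof.
rewrite /hval /hlift /hpt !mul_row_col -[g in RHS]vsubmxK mul_row_col.
by rewrite !mul1mx mul_mx_scalar !mxE; ring.
Qed.

Lemma hliftP (h : 'cV[R]_(d + 1 + 1)) : exists g a, h = hlift g a.
Proof.
exists (col_mx (usubmx (usubmx h)) (dsubmx h)), ((dsubmx (usubmx h)) 0 0).
by rewrite /hlift col_mxKu col_mxKd -mx11_scalar !vsubmxK.
Qed.

Definition pyr (z : option I) : 'rV[R]_(d + 1) :=
  if z is Some i then row_mx (u i) 0 else row_mx 0 1.

Definition pyr_code (p : gcone (face_poset u)) : {set option I} :=
  [set z | if z is Some i then i \in p.1 else p.2]%SET.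

Lemma hval_pyr g a i : hval (hlift g a) (pyr (Some i)) = hval g (u i).
Proof. by rewrite hval_hlift mxE mul0r addr0. Qed.

Lemma hval_apex g a : hval (hlift g a) (pyr None) = hval g 0 + a.
Proof. by rewrite hval_hlift mxE eqxx mul1r. Qed.

(** Every functional upstairs is some [hlift g a]: its values on the base are those of g, while the
    slope sets the apex value [hval g 0 + a] freely. Membership of the apex is thus independent of
    the face of the base. *)
Lemma models_pyr :
  models (T := gcone (face_poset u)) (cset pyr [set: option I]) (cset pyr \o pyr_code).
Proof.
apply: models_code => [[J s] /asboolP[g gJ]|K /asboolP[h hK]|[J s] [K t] _ _].
- apply/asboolP; exists (hlift g ((if s then 0 else 1) - hval g 0)) => -[i|].
    by rewrite hval_pyr inE.
  rewrite hval_apex addrC subrK inE /=.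
  by case: (s); rewrite ?eqxx ?oner_eq0 ?lexx ?ler01.
- have [g [a hE]] := hliftP h; rewrite {}hE in hK.
  exists ([set i | Some i \in K]%SET, None \in K).
    by apply/asboolP; exists g => i; rewrite inE -(hval_pyr g a).
  by apply/setP => -[i|]; rewrite !inE.
rewrite /= /cone_le /=.
apply/fintype.subsetP/andP => [sub|[/fintype.subsetP JK /implyP st]].
  split; first by apply/fintype.subsetP => i; have := sub (Some i); rewrite !inE.
  by apply/implyP; have := sub None; rewrite !inE.
by move=> [i|]; rewrite !inE //; exact: JK.
Qed.

Hypothesis I_gt0 : (0 < #|I|)%N.

Definition bary : 'rV[R]_d := #|I|%:R^-1 *: \sum_i u i.

Lemma hval_bary g : hval g bary = #|I|%:R^-1 * \sum_i hval g (u i).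
Proof.
rewrite /bary scaler_sumr hval_sum ?mulr_sumr //.
by rewrite sumr_const -[LHS]mulr_natr mulVf // pnatr_eq0 -lt0n.
Qed.

Lemma face_poset_gt0 : (0 < gp_rk (gp_top (face_poset u)))%N.
Proof.
rewrite gp_rk_gt0 ?gp_top_dom //=.
apply: contraTneq I_gt0 => /(congr1 (fun A => #|pred_of_set A|)).
by rewrite cardsT cards0 => ->.
Qed.

(** All generators have positive weight in the barycentre, so a nonnegative functional vanishes
    there only if it vanishes at every generator. *)
Lemma hval_bary_gt0 g J : exposes u g J -> (0 < hval g bary) = (J != [set: I]%SET).
Proof.
move=> gJ; have g0 i : 0 <= hval g (u i) by case: (gJ i).
rewrite hval_bary pmulr_rgt0 ?invr_gt0 ?ltr0n // lt_def sumr_ge0 // andbT.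
rewrite psumr_eq0 //; congr (~~ _); apply/allP/eqP => [g_eq0|JT i _].
  apply/setP => i; rewrite inE; have [_ ->] := gJ i.
  by have /= -> := g_eq0 i (mem_index_enum i).
by have [_ <-] := gJ i; rewrite JT inE.
Qed.

Definition bipyr (z : I + bool) : 'rV[R]_(d + 1) :=
  match z with inl i => row_mx (u i) 0 | inr b => row_mx bary (if b then 1 else - 1) end.

Definition bipyr_code (z : gsusp face_poset_gt0) : {set I + bool} :=
  if z is Some (J, s) then
    [set t | match t with inl i => i \in J | inr b => s == Some b end]%SET
  else [set: I + bool]%SET.

Lemma hval_bipyr g a i : hval (hlift g a) (bipyr (inl i)) = hval g (u i).
Proof. by rewrite hval_hlift mxE mul0r addr0. Qed.

Lemma hval_biapex g a b :
  hval (hlift g a) (bipyr (inr b)) = hval g bary + (if b then a else - a).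
Proof. by rewrite hval_hlift; case: b; rewrite !mxE eqxx ?mulN1r ?mul1r. Qed.

(** The apex values are b + a and b - a, with b the value at the barycentre. If b > 0 they cannot
    both vanish; if b = 0, nonnegativity forces a = 0 and the face is everything. *)
Lemma models_bipyr :
  models (T := gsusp face_poset_gt0) (cset bipyr [set: I + bool])
    (cset bipyr \o bipyr_code).
Proof.
apply: models_code => [[[J s]|] /= JD|K /asboolP[h hK]|[[J s]|] [[K t]|] JD KD].
- have /andP[/asboolP[g gJ] JT] := JD.
  have b0 : 0 < hval g bary by rewrite (hval_bary_gt0 gJ).
  (* This slope kills the chosen apex and leaves twice the barycentre value at the other; slope 0
     keeps both positive. *)
  pose a := if s is Some b then (if b then - hval g bary else hval g bary) else 0.
  apply/asboolP; exists (hlift g a) => -[i|b]; first by rewrite hval_bipyr inE.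
  rewrite hval_biapex inE /a.
  case: (s) b => [[]|] [] /=; rewrite ?opprK ?oppr0 ?addr0 ?subrr ?eqxx ?lexx //.
  + by rewrite ltW ?addr_gt0 // gt_eqF // addr_gt0.
  + by rewrite ltW ?addr_gt0 // gt_eqF // addr_gt0.
  + by rewrite ltW // gt_eqF.
  by rewrite ltW // gt_eqF.
- exact: ifaceT.
- have [g [a hE]] := hliftP h; rewrite {}hE in hK.
  pose J := [set i | inl i \in K]%SET.
  have gJ : exposes u g J by move=> i; rewrite inE -(hval_bipyr g a).
  have [t0 tE] := hK (inr true); have [f0 fE] := hK (inr false).
  rewrite hval_biapex in t0 tE; rewrite hval_biapex in f0 fE.
  have := hval_bary_gt0 gJ; case: (eqVneq J [set: I]%SET) => [JT b0|JT b0].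
    exists None => //=; apply/esym/setP => -[i|b]; rewrite inE.
      by have := finset.in_setT i; rewrite -JT inE.
    have bE : hval g bary = 0.
      rewrite hval_bary big1 ?mulr0 // => i _; have [_] := gJ i.
      by rewrite JT inE => /esym/eqP.
    have a0 : a = 0 by rewrite bE in t0 f0; lra.
    by case: b; rewrite ?tE ?fE bE a0 ?oppr0 addr0 eqxx.
  exists (Some (J, if inr true \in K then Some true
                   else if inr false \in K then Some false else None)).
    by apply/andP; split=> //; apply/asboolP; exists g.
  apply/setP => -[i|b]; rewrite !inE //.
  rewrite tE fE; case: b.
    by rewrite tE; case: ifP => //; case: ifP.
  rewrite fE; case: ifP => [/eqP t_eq0|_]; last by case: ifP.
  by apply/esym/negbTE/eqP => f_eq0; move: b0; rewrite /= => b0; lra.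
- rewrite /=; apply/fintype.subsetP/andP => [sub|[/fintype.subsetP JK st]].
    split; first by apply/fintype.subsetP => i; have := sub (inl i); rewrite !inE.
    case: (s) sub => [b|] // sub; have := sub (inr b); rewrite !inE eqxx => /(_ isT).
    by rewrite eq_sym.
  move=> [i|b]; rewrite !inE; first exact: JK.
  by move=> /eqP sb; move: st; rewrite sb /= eq_sym.
- by rewrite /= finset.subsetT.
- have /andP[_ KT] := KD; apply/negbTE; apply: contra KT => /fintype.subsetP sub.
  by apply/eqP/setP => i; have := sub (inl i); rewrite !inE => ->.
by rewrite /= subxx.
Qed.

End PyramidFaces.

(** * Flag numbers as numbers of chains in the poset *)

Lemma card_fset_set_seq (K : choiceType) (B : set K) (s : seq K) :
  uniq s -> (forall x, B x <-> x \in s) -> #|` fset_set B| = size s.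
Proof.
move=> us Bs; have -> : B = [set` s] by apply/seteqP; split=> x /= /Bs.
rewrite -[s in RHS]undup_id // -card_fseq.
congr #|` _|; apply/fsetP => x; rewrite in_fset_set ?finite_seq //.
by rewrite mem_setE in_fset.
Qed.

Section FlagNumber.
Variables (R : realType) (P : polytope R) (T : gposet).
Variable phi : T -> set 'rV[R]_(ambient P).
Hypothesis mod : models (@pset R P) phi.

(** Chains of faces are indexed upwards and chains of [T] downwards, hence the reversals. The
    inclusions in [face_chains] become strict because the dimensions in [a] increase strictly, and
    the faces are proper because these dimensions are below n. *)
Lemma flag_numberE n k (a : k.-tuple nat) : gp_rk (gp_top T) = n.+1 ->
  sorted ltn a -> all (gtn n) a ->
  flag_number P a = #|[pred s : k.-tuple T | dchain (gp_top T) s &&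
                        ([seq gp_rk x | x <- s] == rev [seq j.+1 | j <- a])]|.
Proof.
move=> rkT sa an; have [phiF onto phi_le] := mod.
have dimE : {in gp_dom T, forall x, affine_dim (phi x) = (gp_rk x)%:Z - 1}.
  by apply: (@models_dim _ _ _ (@gen R P)); rewrite -pset_cset.
pose g (s : k.-tuple T) := [ffun i : 'I_k => phi (tnth s (rev_ord i))].
pose A := [pred s : k.-tuple T | dchain (gp_top T) s &&
                        ([seq gp_rk x | x <- s] == rev [seq j.+1 | j <- a])].
rewrite cardE -(size_map g); apply: card_fset_set_seq.
  rewrite map_inj_in_uniq ?enum_uniq // => s t.
  rewrite !mem_enum => /andP[/andP[_ /allP sD] _] /andP[/andP[_ /allP tD] _].
  move=> /ffunP gst; apply: eq_from_tnth => i.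
  have := gst (rev_ord i); rewrite !ffunE rev_ordK => phiE.
  have /andP[siD _] := sD _ (mem_tnth i s).
  have /andP[tiD _] := tD _ (mem_tnth i t).
  by apply: gp_anti; apply/andP; split; apply/phi_le; rewrite ?phiE.
move=> F; split=> [[Fa Fle]|/mapP[s]].
  have /choice[x xP] : forall i, exists x, x \in gp_dom T /\ phi x = F i.
    by move=> i; have [/onto[x xD xE] _] := Fa i; exists x.
  have xD i : x i \in gp_dom T by case: (xP i).
  have xE i : phi (x i) = F i by case: (xP i).
  have xr i : gp_rk (x i) = (tnth a i).+1.
    have [_] := Fa i; rewrite -xE dimE //; lia.
  have xlt (i j : 'I_k) : (i < j)%N -> gp_lt (x i) (x j).
    move=> ij; apply/andP; split.
      by apply/phi_le => //; rewrite !xE; apply: Fle; exact: ltnW.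
    apply: contraTneq (sa) => xij; apply/negP => /(sorted_ltn_nth ltn_trans 0%N).
    move=> /(_ i j); rewrite !inE !size_tuple => /(_ (ltn_ord i) (ltn_ord j) ij).
    by have := xr i; rewrite xij xr !(tnth_nth 0%N) => -[->]; rewrite ltnn.
  pose s := [tuple x (rev_ord i) | i < k].
  apply/mapP; exists s; last first.
    by apply/ffunP => i; rewrite ffunE tnth_mktuple rev_ordK xE.
  rewrite mem_enum; apply/andP; split; first (apply/andP; split).
  - apply/(pathP (gp_top T)) => i; rewrite size_tuple => ik.
    have sE j (jk : (j < k)%N) : nth (gp_top T) s j = x (rev_ord (Ordinal jk)).
      by rewrite -[RHS](tnth_mktuple (fun i => x (rev_ord i))) (tnth_nth (gp_top T)).
    rewrite sE; case: i ik => [|i] ik /=.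
      rewrite /gp_lt gp_top_le //=; apply: contraTneq isT => xt.
      have := xr (rev_ord (Ordinal ik)); rewrite xt rkT => -[nE].
      by have /allP/(_ _ (mem_tnth (rev_ord (Ordinal ik)) a)) := an; rewrite /= -nE ltnn.
    by rewrite (sE _ (ltnW ik)); apply: xlt => /=; lia.
  - by apply/allP => _ /mapP[i _ ->]; rewrite xD xr.
  apply/eqP; apply: (@eq_from_nth _ 0%N) => [|i].
    by rewrite size_map size_rev size_map !size_tuple.
  rewrite size_map size_tuple => ik.
  rewrite nth_rev size_map size_tuple // (nth_map 0%N) ?size_tuple; last by lia.
  rewrite (nth_map (gp_top T)) ?size_tuple //.
  have -> : nth (gp_top T) s i = x (rev_ord (Ordinal ik)).
    by rewrite -[RHS](tnth_mktuple (fun i => x (rev_ord i))) (tnth_nth (gp_top T)).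
  by rewrite xr (tnth_nth 0%N).
rewrite mem_enum => /andP[/andP[ps /allP sD] /eqP sr] ->.
have tD i : tnth s i \in gp_dom T by have /andP[] := sD _ (mem_tnth i s).
split=> [i|i j ij].
  rewrite ffunE; split; first exact: phiF.
  rewrite dimE //; have -> : gp_rk (tnth s (rev_ord i)) = (tnth a i).+1.
    have ki : (rev_ord i < k)%N by exact: ltn_ord.
    rewrite (tnth_nth (gp_top T)) -(nth_map _ 0%N) ?size_tuple // sr.
    rewrite nth_rev size_map size_tuple // (nth_map 0%N) ?size_tuple; last by lia.
    by rewrite (tnth_nth 0%N) /=; congr (nth _ _ _).+1; have := ltn_ord i; lia.
  by lia.
rewrite !ffunE; apply/phi_le => //.
have [->|nij] := eqVneq i j; first exact: gp_refl.
have lt_ij : (i < j)%N by rewrite ltn_neqAle nij.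
have tr : transitive (fun u v => @gp_lt T v u).
  by move=> u v w vu uw; exact: gp_lt_trans uw vu.
have := sorted_ltn_nth tr (gp_top T) (path_sorted ps).
move=> /(_ (rev_ord j) (rev_ord i)); rewrite !inE size_tuple !ltn_ord.
rewrite -!(tnth_nth (gp_top T)) => /(_ isT isT) H.
suff /H/andP[] : (rev_ord j < rev_ord i)%N by [].
by rewrite /=; have := ltn_ord j; lia.
Qed.

End FlagNumber.

Lemma rev_pairmap_subn n x s :
  rev (pairmap (fun x y => y - x)%N x (rcons s n)) = pairmap subn n (rev (x :: s)).
Proof.
elim: s x => [|y s IHs] x //=.
rewrite [LHS]rev_cons IHs [in RHS]rev_cons -(cats1 (rev _)) pairmap_cat cats1.
by rewrite [in last _ _]rev_cons last_rcons.
Qed.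

Lemma pairmap_subnS n s : pairmap subn n.+1 [seq j.+1 | j <- s] = pairmap subn n s.
Proof. by elim: s n => //= j s IHs n; rewrite IHs subSS. Qed.

Section FClass.
Variables (R : realType) (T : gposet) (c : comb_polytope R).
Variable phi : T -> set 'rV[R]_(ambient (repr c)).
Hypothesis mod : models (@pset R (repr c)) phi.

Lemma affine_dim_pset : affine_dim (@pset R (repr c)) = (gp_rk (gp_top T))%:Z - 1.
Proof.
have [phiF onto phi_le] := mod.
have [x xD xE] : exists2 x, x \in gp_dom T & phi x = @pset R (repr c).
  apply: onto; exists 0, 0; split=> [y _|]; first by rewrite mulmx0 mxE.
  by apply/seteqP; split=> y /=; rewrite mulmx0 mxE => // -[].
have tE : phi (gp_top T) = @pset R (repr c).
  apply/seteqP; split.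
    by have [d [b [_ ->]]] := phiF _ (gp_top_dom T) => y [].
  by rewrite -xE; apply/phi_le; rewrite ?gp_top_dom ?gp_top_le.
rewrite -{1}tE; apply: (@models_dim _ _ _ (@gen R (repr c))); rewrite ?gp_top_dom //.
by rewrite -pset_cset; exact: mod.
Qed.

Lemma cdim_models n : gp_rk (gp_top T) = n.+1 -> cdim c = n.
Proof. by move=> rkT; rewrite /cdim /pdim affine_dim_pset rkT; lia. Qed.

(** With [n <= m] the lengths in [f_class] run up to n and miss no chain. Chains with the same
    dimensions have the same weight, and a flag number counts them. *)
Lemma f_class_chsum m n : gp_rk (gp_top T) = n.+1 -> (n <= m)%N ->
  f_class m c = chsum (qmono m) (gp_top T).
Proof.
move=> rkT nm; rewrite /f_class (cdim_models rkT) (minn_idPr nm).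
rewrite /chsum (@chsum_rec_stable _ _ _ n) ?gp_top_dom ?rkT // chsum_recE.
rewrite [RHS]big_ltn // (@big_tuple0 _ _ (dchain _)) //; congr (_ + _).
  by rewrite /chain_weight /= rkT /qmono Mqsym_Mlist Mlist0 mul1r.
apply: eq_big_nat => k /andP[k0 kn].
case: n rkT nm kn => [|n] rkT nm kn; first by move: k0 kn; lia.
case: k k0 kn => // k _ kn.
pose dims (s : k.+1.-tuple T) : k.+1.-tuple 'I_n.+1 :=
  [tuple of rev [seq inord (gp_rk x).-1 | x <- s]].
have dimsE (s : k.+1.-tuple T) : dchain (gp_top T) s ->
    [seq j.+1 | j <- [seq val i | i <- dims s]] = rev [seq gp_rk x | x <- s].
  move=> /andP[/order_path_min top_s /allP sD].
  rewrite /= !map_rev -!map_comp; congr rev; apply/eq_in_map => x xs /=.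
  have /andP[xD x0] := sD _ xs.
  have : (gp_rk x < n.+2)%N.
    rewrite -rkT gp_lt_rk ?gp_top_dom //; apply: (allP (top_s _)) xs.
    by move=> u v w vu uw; exact: gp_lt_trans uw vu.
  by move=> xn; rewrite inordK ?prednK // -ltnS prednK.
have dimsP (s : k.+1.-tuple T) (a : k.+1.-tuple 'I_n.+1) : dchain (gp_top T) s ->
    (dims s == a) =
    ([seq gp_rk x | x <- s] == rev [seq j.+1 | j <- [seq val i | i <- a]]).
  move=> ds; rewrite -(can2_eq revK revK) -dimsE // (inj_eq (inj_map succn_inj)).
  by rewrite (inj_eq (inj_map val_inj)).
rewrite (partition_big dims (fun a => sorted ltn [seq val i | i <- a])) /=; last first.
  move=> s ds; have -> : sorted ltn [seq val i | i <- dims s] =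
      sorted ltn [seq j.+1 | j <- [seq val i | i <- dims s]] by rewrite [RHS]sorted_map.
  rewrite dimsE // rev_sorted sorted_map; have /andP[/path_sorted ss sD] := ds.
  apply: sub_in_sorted sD ss => x y /andP[xD _] /andP[yD _]; exact: gp_lt_rk.
apply: eq_bigr => a sa.
rewrite (flag_numberE mod rkT) //=; last first.
  by apply/allP => _ /mapP[i _ ->] /=.
rewrite -sumr_const; apply: eq_big => [s|s].
  by rewrite inE; apply/andb_id2l => ds; rewrite dimsP.
rewrite inE => /andP[ds /eqP sr]; rewrite /chain_weight -last_map sr rkT.
(* Ranks exceed dimensions by one throughout, which leaves the gaps unchanged. *)
rewrite -map_rev pairmap_subnS; case/tupleP: a sa sr => a1 a' sa sr.
rewrite /gaps /= rev_pairmap_subn /qmono; congr (_ * 'X^_).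
by rewrite last_map rev_cons last_rcons.
Qed.

End FClass.

(** * The maps f_m, A and C on polytopes *)

Section PolytopeGroup.
Variable R : realType.

Lemma linear_extE (V : zmodType) (f : comb_polytope R -> V) (p : polytope_group R)
    (E : seq (comb_polytope R)) : uniq E -> {subset dom p <= E} ->
  linear_ext f p = \sum_(c <- E) f c *~ coeff c p.
Proof.
move=> uE sE; rewrite (bigID (mem (dom p))) /= [X in _ = _ + X]big1 ?addr0.
  rewrite -big_filter; apply: perm_big; apply: uniq_perm.
  - exact: uniq_dom.
  - exact: filter_uniq.
  by move=> c; rewrite mem_filter; case: (boolP (c \in dom p)) => // /sE ->.
by move=> c /coeff_outdom->; rewrite mulr0z.
Qed.

Fact linear_ext_is_additive (V : zmodType) (f : comb_polytope R -> V) :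
  zmod_morphism (linear_ext f).
Proof.
move=> p q; pose E := undup (dom p ++ dom q ++ dom (p - q)).
rewrite !(@linear_extE _ f _ E) ?undup_uniq //; first last.
- by move=> c; rewrite mem_undup !mem_cat => ->; rewrite ?orbT.
- by move=> c; rewrite mem_undup !mem_cat => ->; rewrite ?orbT.
- by move=> c; rewrite mem_undup !mem_cat => ->; rewrite ?orbT.
by rewrite -sumrB; apply: eq_bigr => c _; rewrite coeffB mulrzBr.
Qed.

HB.instance Definition _ (V : zmodType) (f : comb_polytope R -> V) :=
  GRing.isZmodMorphism.Build (polytope_group R) V (linear_ext f)
    (linear_ext_is_additive f).

HB.instance Definition _ m :=
  GRing.isZmodMorphism.Build (polytope_group R) {poly {mpoly int[m]}} (@f_poly R m)
    (linear_ext_is_additive (@f_class R m)).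

Lemma linear_extU (V : zmodType) (f : comb_polytope R -> V) k c :
  linear_ext f << k *g c >> = f c *~ k.
Proof.
rewrite (@linear_extE _ _ _ [:: c]) //.
  by rewrite big_seq1 coeffU eqxx mulr1.
by move=> x; rewrite mem_dom coeffU inE; have [//|_] := eqVneq x c; rewrite mulr0 eqxx.
Qed.

Lemma comb_equivalent_repr (P : polytope R) :
  comb_equivalent P (repr (\pi_(comb_polytope R) P)).
Proof. by apply/asboolP; apply/(eqmodP (comb_equiv R)); rewrite reprK. Qed.

Lemma pset_pyramid (P : polytope R) :
  @pset R (pyramid P) = cset (pyr (@gen R P)) [set: option 'I_(size (generators P))].
Proof.
have sz : (size (generators P)).+1 = size (pyramid_pts (generators P)).
  by rewrite /= size_map.
pose e (z : option 'I_(size (generators P))) : 'I_(size (pyramid_pts (generators P))) :=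
  cast_ord sz (if z is Some i then fintype.lift ord0 i else ord0).
apply: (conv_hull_cset (e := e)) => [|[i|]] //=.
  apply: inj_card_bij; last by rewrite card_option !card_ord /= size_map.
  by move=> [i|] [j|] /cast_ord_inj //= /lift_inj->.
by rewrite !add0n (nth_map 0).
Qed.

Lemma pset_bipyramid (P : polytope R) :
  @pset R (bipyramid P) =
  cset (bipyr (@gen R P)) [set: 'I_(size (generators P)) + bool].
Proof.
set V := generators P.
have sz : (size V).+2 = size (bipyramid_pts V) by rewrite /= size_map.
pose e (z : 'I_(size V) + bool) : 'I_(size (bipyramid_pts V)) :=
  cast_ord sz (match z with
    | inl i => fintype.lift ord0 (fintype.lift ord0 i)
    | inr b => if b then ord0 else fintype.lift ord0 ord0 end).
have bE : barycentre V = bary (@gen R P).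
  by rewrite /barycentre /bary card_ord (big_nth 0) big_mkord.
apply: (conv_hull_cset (e := e)) => [|[i|[]]] /=; rewrite -?bE //.
  apply: inj_card_bij; last by rewrite card_sum card_bool !card_ord /= size_map addn2.
  by move=> [i|[]] [j|[]] /cast_ord_inj //= /lift_inj // /lift_inj->.
by rewrite !add0n (nth_map 0).
Qed.

Section FClassOps.
Variables (c : comb_polytope R) (m : nat).
Hypothesis c_le_m : (cdim c <= m)%N.

Let P := repr c.
Let T := face_poset (@gen R P).

Let T_mod : models (T := T) (@pset R P) (cset (@gen R P)).
Proof. rewrite pset_cset; exact: models_face_poset. Qed.

Let gens_gt0 : (0 < #|'I_(size (generators P))|)%N.
Proof. by rewrite card_ord lt0n size_eq0 generators_neq0. Qed.

Let T_gt0 := face_poset_gt0 (@gen R P) gens_gt0.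

Let rk_top : gp_rk (gp_top T) = (cdim c).+1.
Proof.
have := T_gt0; rewrite -/T; case E : (gp_rk _) => [|k] // _.
by rewrite (cdim_models T_mod E).
Qed.

(** This is where [cdim c <= m] guarantees that [vext] extends every M_w that occurs. *)
Let size_lt (w : seq nat) : (size w < gp_rk (gp_top T))%N -> (size w <= m)%N.
Proof. by rewrite rk_top ltnS => /leq_trans; apply. Qed.

Lemma f_class_cpyramid_chsum :
  f_class m.+1 (cpyramid c) = chsum (qmono m.+1) ((gp_top T, true) : gcone T).
Proof.
have pmod : models (T := gcone T) (@pset R (pyramid P))
    (cset (pyr (@gen R P)) \o @pyr_code R _ _ (@gen R P)).
  by rewrite pset_pyramid; exact: models_pyr.
have [phi mod] := models_comb_equivalent (comb_equivalent_repr (pyramid P)) pmod.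
apply: (f_class_chsum mod (n := (cdim c).+1)) => //.
exact: etrans (addn1 _) (congr1 S rk_top).
Qed.

Lemma f_class_cbipyramid_chsum :
  f_class m.+1 (cbipyramid c) = chsum (qmono m.+1) (None : gsusp T_gt0).
Proof.
have bmod := models_bipyr (@gen R P) gens_gt0; rewrite -pset_bipyramid in bmod.
have [phi mod] := models_comb_equivalent (comb_equivalent_repr (bipyramid P)) bmod.
by apply: (f_class_chsum mod (n := (cdim c).+1)) => //; rewrite -rk_top.
Qed.

Lemma f_class_opC : f_class m.+1 (cpyramid c) = qsC (f_class m c).
Proof.
rewrite f_class_cpyramid_chsum chsum_cone ?gp_top_dom //.
rewrite (f_class_chsum T_mod rk_top c_le_m) [RHS](raddf_chsum (@qsC m)) ?gp_top_dom //.
apply: eq_chsum; rewrite ?gp_top_dom // => a w cw /size_lt wm.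
by rewrite /= qsC_qmono.
Qed.

Lemma f_class_opA :
  f_class m.+1 (cpyramid c) *+ 2 - f_class m.+1 (cbipyramid c) = qsA (f_class m c).
Proof.
rewrite f_class_cpyramid_chsum f_class_cbipyramid_chsum chsum_susp.
rewrite (f_class_chsum T_mod rk_top c_le_m) [RHS](raddf_chsum (@qsA m)) ?gp_top_dom //.
apply: eq_chsum; rewrite ?gp_top_dom // => a w cw /size_lt wm.
by rewrite /= qsA_qmono.
Qed.

End FClassOps.

End PolytopeGroup.

Theorem proposition10 (R : realType) (m : nat) :
  [/\ (forall g, QsymA g -> QsymA (@qsA m g)) /\
      (forall (z : int) g h, QsymA g -> QsymA h ->
         @qsA m (g *~ z + h) = qsA g *~ z + qsA h),
      (forall g, QsymA g -> QsymA (@qsC m g)) /\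
      (forall (z : int) g h, QsymA g -> QsymA h ->
         @qsC m (g *~ z + h) = qsC g *~ z + qsC h)
    & forall (n : nat) (p : polytope_group R),
        homogeneous n p -> (n <= m)%N ->
        f_poly m.+1 (opA p) = qsA (f_poly m p) /\
        f_poly m.+1 (opC p) = qsC (f_poly m p)].
Proof.
split=> [||n _ [s [sn ->]] nm].
- split=> [g|z g h _ _]; first exact: QsymA_qsA.
  by rewrite raddfD raddfMz.
- split=> [g|z g h _ _]; first exact: QsymA_qsC.
  by rewrite raddfD raddfMz.
have cn x : x \in s -> (cdim x.2 <= m)%N by move=> /sn->.
set p := \sum_(x <- s) _.
(* The list [s] may repeat a class, so its integers need not be coefficients of p; additivity
   evaluates the extension term by term. *)
have extE (V : zmodType) (f : comb_polytope R -> V) :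
    linear_ext f p = \sum_(x <- s) f x.2 *~ x.1.
  by rewrite raddf_sum; apply: eq_bigr => x _; rewrite /= linear_extU.
have opE (op : comb_polytope R -> comb_polytope R) :
    f_poly m.+1 (linear_ext (fun c => << op c >>) p) =
    \sum_(x <- s) f_class m.+1 (op x.2) *~ x.1.
  rewrite extE /f_poly raddf_sum; apply: eq_bigr => x _.
  by rewrite raddfMz /= linear_extU mulr1z.
have opCE := opE (@cpyramid R); have opBE := opE (@cbipyramid R).
split.
  rewrite /opA raddfB raddfMn /= opCE opBE [f_poly m p]extE [RHS]raddf_sum.
  rewrite -sumrMnl -sumrB big_seq [RHS]big_seq; apply: eq_bigr => x /cn xm.
  rewrite [RHS]raddfMz /= -f_class_opA // mulrzBl.
  by rewrite mulr2n -mulrzDl -mulr2n.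
rewrite [LHS]opCE [f_poly m p]extE [RHS]raddf_sum big_seq [RHS]big_seq.
by apply: eq_bigr => x /cn xm; rewrite [RHS]raddfMz /= f_class_opC.
Qed.
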